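(* Let $\alpha\in\mathbb{C}$ with $\alpha\notin\mathbb{Z}$ and $\mathrm{Re}\,\alpha>-1/2$, and let $\phi(e^{i\theta})=u_\alpha(e^{i\theta})=(2-2\cos\theta)^\alpha$. Then, as $n\to\infty$, $$\det M_n(\phi)\sim n^{(\alpha^2-\alpha)/2}\,(2\pi)^{-\alpha/2}\,2^{3\alpha^2/2}\,\frac{G(3/2+\alpha)\,G(1+\alpha)^2}{G(3/2)\,G(1+2\alpha)}.$$
   Context: $\phi_k=\frac1{2\pi}\int_0^{2\pi}\phi(e^{i\theta})e^{-ik\theta}d\theta$ is the $k$-th Fourier coefficient, and $M_n(\phi)=(\phi_{j-k}+\phi_{j+k+1})_{j,k=0}^{n-1}$. $G(\cdot)$ is the Barnes G-function, $G(1+z)=(2\pi)^{z/2}e^{-(z+1)z/2-\gamma_E z^2/2}\prod_{k=1}^\infty\left((1+z/k)^k e^{-z+z^2/(2k)}\right)$, with $\gamma_E$ Euler's constant. $a_n\sim c_n$ means $a_n=c_n(1+o(1))$ as $n\to\infty$. *)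

(* Defs.v *)
From HB Require Import structures.
From mathcomp Require Import all_boot all_order all_algebra.
From mathcomp Require Import complex.
From mathcomp Require Import all_classical all_reals all_analysis.
Set Implicit Arguments.
Unset Strict Implicit.
Unset Printing Implicit Defensive.
Import Order.TTheory GRing.Theory Num.Theory.
Import numFieldNormedType.Exports.
Local Open Scope classical_set_scope.
Local Open Scope complex_scope.
Local Open Scope ring_scope.

Definition expC (R : realType) (z : R[i]) : R[i] :=
  (expR (complex.Re z))%:C * (cos (complex.Im z) +i* sin (complex.Im z)).

Definition cis (R : realType) (t : R) : R[i] := cos t +i* sin t.

(* The principal power x^w of a positive real x; not meaningful for x <= 0,
   where [ln x] is the junk value 0. *)
Definition powC (R : realType) (x : R) (w : R[i]) : R[i] :=
  expC (w * (ln x)%:C).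

Definition integralC (R : realType) (D : set R) (f : R -> R[i]) : R[i] :=
  (\int[@lebesgue_measure R]_(t in D) complex.Re (f t)) +i*
  (\int[@lebesgue_measure R]_(t in D) complex.Im (f t)).

Definition fourier (R : realType) (phi : R[i] -> R[i]) (k : int) : R[i] :=
  ((2 * pi)^-1)%:C *
  integralC `[0, 2 * pi] (fun t => phi (cis t) * cis (- (k%:~R * t))).

Definition toeplitz_hankel (R : realType) (phi : R[i] -> R[i]) (n : nat) :
    'M[R[i]]_n :=
  \matrix_(j < n, k < n)
    (fourier phi (j%:Z - k%:Z) + fourier phi (j%:Z + k%:Z + 1)).

Definition euler_gamma (R : realType) : R :=
  limn (fun n : nat => \sum_(1 <= k < n.+1) k%:R^-1 - ln (n%:R : R)).

(* [barnesG1 z] is G(1 + z); the [^o] selects the normed-module structure of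
   R[i], so [limn] is the limit for the usual topology of the plane. *)
Definition barnesG1 (R : realType) (z : R[i]) : R[i] :=
  powC (2 * pi) (z / 2)
  * expC (- ((z + 1) * z / 2) - (euler_gamma R)%:C * z ^+ 2 / 2)
  * limn (fun n : nat => (\prod_(1 <= k < n.+1)
      ((1 + z / k%:R) ^+ k * expC (- z + z ^+ 2 / (2 * k%:R))) : R[i]^o)).

Definition barnesG (R : realType) (w : R[i]) : R[i] := barnesG1 (w - 1).

(* Main.v *)
Require Import Defs.
From HB Require Import structures.
From mathcomp Require Import all_boot all_order all_algebra.
From mathcomp Require Import complex.
From mathcomp Require Import all_classical all_reals all_analysis.
From mathcomp Require Import measurable_realfun.
From mathcomp Require Import ring lra zify.
Set Implicit Arguments.
Unset Strict Implicit.
Unset Printing Implicit Defensive.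
Import Order.TTheory GRing.Theory Num.Theory.
Import numFieldNormedType.Exports.
Local Open Scope classical_set_scope.
Local Open Scope complex_scope.
Local Open Scope ring_scope.
Import Normc.

(** The determinant has an exact product formula, and the asymptotics are read
    off from it.

    Exact formula. As phi is even, the entry (j, k) is the mean of phi against
    2 cos ((j + 1/2) t) cos ((k + 1/2) t). With x = cos t the matrix is therefore
    the Gram matrix, in the basis cos ((j + 1/2) t) / cos (t / 2) of polynomials
    in x, of the Jacobi weight (1 - x)^(alpha - 1/2) (1 + x)^(1/2), whose
    determinant is a product of Gamma quotients. In terms of
      B_k = prod_(1 <= i <= k) (1 + alpha / i)      ([ratioB]),
      H_k = prod_(0 <= i < k) (1 + alpha / (i + 1/2))   ([ratioH])
    it reads
      det M_n = prod_(k < n) phi_0 H_k B_k / (B_2k B_(2k+1))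
    ([det_toeplitz_hankel_ratio]). The computation is purely algebraic: all that
    it takes from analysis is that the Fourier coefficients are even and satisfy
    (alpha - k) phi_k + (alpha + k + 1) phi_(k+1) = 0, which is one integration
    by parts ([fourier_int_rec]).

    The coefficient phi_0. It occurs to the power n, so its exact value matters;
    it is Gamma(1 + 2 alpha) / Gamma(1 + alpha)^2, but only in the form
    phi_0 = lim t_n with t_n = 4^alpha B_n / H_n ([fourier_coef0_cvg]). Passing
    from alpha to alpha + 1 multiplies the integral of u^alpha, with
    u = 2 - 2 cos t, by an explicit rational factor ([fourier_int_shift]), and
    for large N the measure u^N dt concentrates at u = 4, so that the integral
    of u^(alpha + N) is about 4^alpha times that of u^N ([fourier_int_laplace]).

    Asymptotics. The Barnes products are compared with det M_n at finite level:
    truncate those of G(3/2 + alpha), G(1 + alpha) and G(3/2) after n factors and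
    that of G(1 + 2 alpha) after 2n. The even-numbered factors of the last one
    cancel G(1 + alpha)^2 and the odd-numbered ones combine with the other two,
    leaving prod_(k < n) H_k / H_n^n times elementary factors
    ([barnes_ratioE]). The same product is the main part of det M_n
    ([det_product_split]). What remains in the quotient is (phi_0 / t_n)^n, which
    tends to exp (- alpha / 2) ([ratio_coef0_power]), and the product of the
    B_m / B_n for n <= m < 2n, in which only factors 1 + alpha / i with i > n
    occur, so that expanding their logarithms to second order suffices
    ([cvgC_block_prod]). The powers of 2 pi cancel, ln n and the Euler constant
    occur only in the combination (harmonic number) - ln n - gamma, and the other
    exponents converge by the first-order asymptotics of harmonic sums over
    ]n, 2n] ([asymptotic_ratio]). *)

(** * The determinant as a Gram determinant for a Jacobi weight *)
Section JacobiFunctional.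
Variable F : numFieldType.
Implicit Types (a x y c : F) (p q : {poly F}).

Definition rising x n := \prod_(i < n) (x + i%:R).

Lemma rising0 x : rising x 0 = 1. Proof. by rewrite /rising big_ord0. Qed.

Lemma risingS x n : rising x n.+1 = rising x n * (x + n%:R).
Proof. by rewrite /rising big_ord_recr. Qed.

Lemma risingD x m n : rising x (m + n) = rising x m * rising (x + m%:R) n.
Proof.
elim: n => [|n IH]; first by rewrite addn0 rising0 mulr1.
by rewrite addnS !risingS IH -mulrA natrD addrA.
Qed.

Lemma rising_neq0 x n : (forall i : nat, x + i%:R != 0) -> rising x n != 0.
Proof. by move=> hx; rewrite /rising; apply/prodf_neq0 => i _. Qed.

Lemma poly_monomial_ind (P : {poly F} -> Prop) :
    P 0 -> (forall p q, P p -> P q -> P (p + q)) ->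
    (forall c i, P (c *: 'X^i)) -> forall p, P p.
Proof.
move=> P0 PD PX p; rewrite -[p]coefK poly_def.
by elim/big_ind: _ => // i _; apply: PX.
Qed.

(** Up to the normalisation of its value at 1, integration against the weight
    s^(a - 1/2) (1 - s)^(-1/2) ds on [0, 1], written through its moments so that
    it makes sense over any field. The variable is s = (1 - cos t) / 2. *)
Definition jacL a (f0 : F) p : F :=
  \sum_(i < size p) p`_i * (f0 * (rising (a + 2^-1) i / rising (a + 1) i)).

Lemma jacL_wide a (f0 : F) p n : (size p <= n)%N ->
  jacL a f0 p = \sum_(i < n) p`_i * (f0 * (rising (a + 2^-1) i / rising (a + 1) i)).
Proof.
move=> hp; rewrite /jacL (big_ord_widen n (fun i => p`_i * (f0 * (rising (a + 2^-1) i / rising (a + 1) i)))) //.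
rewrite big_mkcond /=; apply: eq_bigr => i _; case: ltnP => // h.
by rewrite nth_default ?mul0r.
Qed.

Lemma jacL_is_linear a (f0 : F) : linear_for *%R (jacL a f0).
Proof.
move=> c p q; set n := maxn (size p) (size q).
have h : (size (c *: p + q)%R <= n)%N.
  rewrite (leq_trans (size_polyD _ _)) // geq_max leq_maxr andbT.
  by rewrite (leq_trans (size_scale_leq _ _)) // leq_maxl.
rewrite (jacL_wide _ _ h) (jacL_wide _ _ (leq_maxl _ _ : (size p <= n)%N)).
rewrite (jacL_wide _ _ (leq_maxr _ _ : (size q <= n)%N)) mulr_sumr -big_split /=.
by apply: eq_bigr => i _; rewrite coefD coefZ mulrDl -!mulrA.
Qed.

HB.instance Definition _ a (f0 : F) :=
  GRing.isLinear.Build F {poly F} F *%R (jacL a f0) (jacL_is_linear a f0).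

Lemma jacLM a (f0 : F) c p : jacL a f0 (c%:P * p) = c * jacL a f0 p.
Proof. by rewrite mul_polyC linearZ. Qed.

Section Fixed.
Variables (a f0 : F).
Hypothesis ha : forall i : nat, a + 1 + i%:R != 0.
Notation L := (jacL a f0).

Lemma rising_a1_neq0 n : rising (a + 1) n != 0.
Proof. exact: rising_neq0. Qed.

Lemma jacL_X i : L 'X^i = f0 * (rising (a + 2^-1) i / rising (a + 1) i).
Proof.
rewrite /jacL size_polyXn big_ord_recr /= big1 ?add0r ?coefXn ?eqxx ?mul1r //.
by move=> j _; rewrite coefXn ltn_eqF // mul0r.
Qed.

(** The Beta integral: 'X^i * (1 - 'X)^j only shifts the two exponents of the
    weight. *)
Lemma jacL_beta i j : L ('X^i * (1 - 'X) ^+ j) =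
  f0 * (rising (a + 2^-1) i * rising 2^-1 j / rising (a + 1) (i + j)).
Proof.
elim: j i => [|j IH] i; first by rewrite mulr1 jacL_X addn0 rising0 mulr1.
have -> : 'X^i * (1 - 'X) ^+ j.+1 =
   ('X^i * (1 - 'X) ^+ j) - ('X^(i.+1) * (1 - 'X) ^+ j) :> {poly F} by rewrite !exprS; ring.
rewrite raddfB /= !IH addSn addnS !risingS.
have h1 := ha (i + j); have h2 := rising_a1_neq0 (i + j).
rewrite natrD in h1 *.
by field; rewrite h1 h2.
Qed.

(** The argument of the functional is the total derivative of
    2 s^(a + 1/2) (1 - s)^(1/2) p(s) divided by the weight, and the boundary terms
    vanish. *)
Lemma jacL_pearson p : L (2%:P * 'X * (1 - 'X) * p^`() +
   ((1 - 2%:P * 'X) + (2 * a)%:P * (1 - 'X)) * p) = 0.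
Proof.
elim/poly_monomial_ind: p => [|p q Hp Hq|c i].
- by rewrite deriv0 !mulr0 addr0 raddf0.
- rewrite -[RHS]addr0 -{1}Hp -Hq -raddfD /= derivD; congr (L _); ring.
have -> : 2%:P * 'X * (1 - 'X) * (c *: 'X^i)^`() +
   ((1 - 2%:P * 'X) + (2 * a)%:P * (1 - 'X)) * (c *: 'X^i) =
   (c * (2 * i%:R + 1 + 2 * a))%:P * 'X^i
     - (c * (2 * i%:R + 2 + 2 * a))%:P * 'X^(i.+1) :> {poly F}.
  rewrite derivZ derivXn -!mul_polyC !polyCM !polyCD !polyCM.
  rewrite -mulr_natl -polyC_natr exprS.
  case: i => [|i]; last by rewrite /= exprS; ring.
  by rewrite /= ; ring.
rewrite raddfB /= !jacLM !jacL_X !risingS.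
have h2 := rising_a1_neq0 i; have h1 := ha i.
by field; rewrite h1 h2.
Qed.
End Fixed.

(** With s = (1 - cos t) / 2, [chebT j] is cos (j t) and [chebQ j] is
    cos ((j + 1/2) t) / cos (t / 2). The step is the pair of addition formulas
    cos (j t) + cos ((j + 1) t) = 2 cos (t / 2) cos ((j + 1/2) t) and
    cos ((j + 1/2) t) + cos ((j + 3/2) t) = 2 cos (t / 2) cos ((j + 1) t), where
    2 cos (t / 2)^2 = 2 (1 - s). *)
Definition chebStep (tq : {poly F} * {poly F}) : {poly F} * {poly F} :=
  let t := 2%:P * (1 - 'X) * tq.2 - tq.1 in (t, 2%:P * t - tq.2).
Definition chebT j := (iter j chebStep (1, 1)).1.
Definition chebQ j := (iter j chebStep (1, 1)).2.

Lemma chebTS j : chebT j.+1 = 2%:P * (1 - 'X) * chebQ j - chebT j.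
Proof. by []. Qed.
Lemma chebQS j : chebQ j.+1 = 2%:P * chebT j.+1 - chebQ j.
Proof. by []. Qed.

Lemma chebQ1 : chebQ 1 = 2%:P * (1 - 2%:P * 'X) * chebQ 0 - chebQ 0.
Proof. rewrite chebQS chebTS /chebT /chebQ /=; ring. Qed.

Lemma chebQSS j : chebQ j.+2 = 2%:P * (1 - 2%:P * 'X) * chebQ j.+1 - chebQ j.
Proof. rewrite (chebQS j.+1) (chebTS j.+1) (chebQS j); ring. Qed.

(** Since 4 s (1 - s) = (sin t)^2, the operator 2 s (1 - s) d/ds is (sin t) d/dt;
    these are the derivatives of the two trigonometric functions. *)
Lemma cheb_deriv j :
  2%:P * 'X * (1 - 'X) * (chebT j)^`() = j%:R%:P * (2%:P * (1 - 'X)) * (chebQ j - chebT j)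
  /\ 2%:P * 'X * (1 - 'X) * (chebQ j)^`() =
     (j%:R%:P * (2%:P * (1 - 'X)) + 1) * chebQ j - (2 * j%:R + 1)%:P * chebT j.
Proof.
elim: j => [|j [IT IQ]].
  by rewrite /chebT /chebQ /= !poly.derivE !polyCD !polyCM polyC0 polyC1; split; ring.
have dT : 2%:P * 'X * (1 - 'X) * (chebT j.+1)^`() =
    (j.+1)%:R%:P * (2%:P * (1 - 'X)) * (chebQ j.+1 - chebT j.+1).
  have -> : 2%:P * 'X * (1 - 'X) * (chebT j.+1)^`() =
     - 4%:P * 'X * (1 - 'X) * chebQ j + 2%:P * (1 - 'X) * (2%:P * 'X * (1 - 'X) * (chebQ j)^`())
      - 2%:P * 'X * (1 - 'X) * (chebT j)^`().
    rewrite chebTS !poly.derivE.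
    ring.
  rewrite IT IQ chebQS chebTS -natr1 !polyCD !polyCM polyC1; ring.
split=> //.
have -> : 2%:P * 'X * (1 - 'X) * (chebQ j.+1)^`() =
   2%:P * (2%:P * 'X * (1 - 'X) * (chebT j.+1)^`()) - 2%:P * 'X * (1 - 'X) * (chebQ j)^`().
  by rewrite chebQS derivB derivM derivC; ring.
rewrite dT IQ chebQS chebTS -natr1 !polyCD !polyCM !polyCD polyC1; ring.
Qed.

Section Gram.
Variables (a : F) (f : int -> F).
Hypothesis ha : forall i : nat, a + 1 + i%:R != 0.
Hypothesis f_even : forall k : int, f (- k) = f k.
Hypothesis f_rec : forall k : int, (a - k%:~R) * f k + (a + k%:~R + 1) * f (k + 1) = 0.
Notation L := (jacL a (f 0)).

(** The first-order recurrence of the coefficients is [jacL_pearson] applied to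
    [chebQ j]; hence the functional is the mean against the even function with
    Fourier coefficients f. *)
Lemma jacL_chebT j : L (chebT j) = f j.
Proof.
elim: j => [|j IH].
  by rewrite /chebT /= -[1]/('X^0) jacL_X !rising0 divr1 mulr1.
have := jacL_pearson (f 0) ha (chebQ j); rewrite (cheb_deriv j).2.
have -> : (j%:R%:P * (2%:P * (1 - 'X)) + 1) * chebQ j - (2 * j%:R + 1)%:P * chebT j +
  (1 - 2%:P * 'X + (2 * a)%:P * (1 - 'X)) * chebQ j =
  (a - j%:R)%:P * chebT j + (a + j%:R + 1)%:P * chebT j.+1.
  by rewrite chebTS !polyCD !polyCM !polyCN polyC1; ring.
rewrite raddfD /= !jacLM IH => e.
have e' : (a - j%:R) * f j + (a + j%:R + 1) * f (j%:Z + 1) = 0 := f_rec j.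
have -> : (j.+1 : int) = j%:Z + 1 by lia.
have h : a + j%:R + 1 != 0 by rewrite addrAC.
apply: (mulfI h); apply: (addrI ((a - j%:R) * f j)).
by rewrite e e'.
Qed.

(** Both sides satisfy N(j, k+2) + N(j, k) = N(j+1, k+1) + N(j-1, k+1), multiplication
    by 2 cos t on either factor, with the reflection N(-1, k) = N(0, k). This
    reduces the identity to k = 0, that is to [jacL_chebT]. *)
Lemma jacL_gram (k j : nat) :
  L (2%:P * (1 - 'X) * chebQ j * chebQ k) = f (j%:Z - k%:Z) + f (j%:Z + k%:Z + 1).
Proof.
(* Two consecutive values of k are proved together; the value k = 1 follows from
   k = 0 because chebQ 1 = (2 cos t - 1) chebQ 0. *)
pose N j k := L (2%:P * (1 - 'X) * chebQ j * chebQ k).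
have N0 i : N i 0%N = f i + f (i%:Z + 1).
  rewrite /N {2}/chebQ /= mulr1.
  have -> : 2%:P * (1 - 'X) * chebQ i = chebT i + chebT i.+1 by rewrite chebTS; ring.
  rewrite raddfD /= !jacL_chebT; have -> : (i.+1 : int) = i%:Z + 1 by lia.
  by [].
have S0 i : L (2%:P * (1 - 'X) * (2%:P * (1 - 2%:P * 'X) * chebQ 0) * chebQ i) = N 1%N i + N 0%N i.
  by rewrite /N -raddfD /= chebQ1; congr (L _); ring.
have SS l i : L (2%:P * (1 - 'X) * (2%:P * (1 - 2%:P * 'X) * chebQ l.+1) * chebQ i) = N l.+2 i + N l i.
  by rewrite /N -raddfD /= chebQSS; congr (L _); ring.
have N1 i : N i 1%N = f (i%:Z - 1) + f (i%:Z + 2).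
  have -> : N i 1%N = L (2%:P * (1 - 'X) * (2%:P * (1 - 2%:P * 'X) * chebQ i) * chebQ 0) - N i 0%N.
    by rewrite /N chebQ1 -raddfB /=; congr (L _); ring.
  case: i => [|i]; rewrite ?S0 ?SS !N0 ?sub0r ?f_even ?addr0.
    by rewrite !add0r; ring.
  have -> : (i.+2 : int) = i%:Z + 2 by lia.
  have -> : (i.+1 : int) = i%:Z + 1 by lia.
  rewrite addrK -!addrA; ring.
rewrite -/(N j k).
suff H : (forall j : nat, N j k = f (j%:Z - k%:Z) + f (j%:Z + k%:Z + 1)) /\
        (forall j : nat, N j k.+1 = f (j%:Z - k.+1%:Z) + f (j%:Z + k.+1%:Z + 1)) by exact: H.1.
elim: k {j} => [|k [H1 H2]].
  split=> i.
    by rewrite N0; congr (f _ + f _); lia.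
  by rewrite N1; congr (f _ + f _); lia.
split=> // j.
have -> : N j k.+2 = L (2%:P * (1 - 'X) * (2%:P * (1 - 2%:P * 'X) * chebQ j) * chebQ k.+1) - N j k.
  by rewrite /N chebQSS -raddfB /=; congr (L _); ring.
case: j => [|j]; rewrite ?S0 ?SS H1 !H2.
  have eq_f (x y : int) : x = y -> f x = f y by move=> ->.
  rewrite (eq_f (1%N%:Z - k.+1%:Z) (- k%:Z)) ?(eq_f (0%N%:Z - k.+1%:Z) (- k.+1%:Z));
    rewrite ?(eq_f (0%N%:Z - k%:Z) (- k%:Z)) ?(eq_f (0%N%:Z - k.+2%:Z) (- k.+2%:Z)); try lia.
  rewrite !f_even (eq_f (0%N%:Z + k.+1%:Z + 1) k.+2) ?(eq_f (0%N%:Z + k%:Z + 1) k.+1);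
   rewrite ?(eq_f (1%N%:Z + k.+1%:Z + 1) k.+3) ?(eq_f (0%N%:Z + k.+2%:Z + 1) k.+3); try lia.
  ring.
have eq_f (x y : int) : x = y -> f x = f y by move=> ->.
rewrite (eq_f (j.+2%:Z - k.+1%:Z) (j.+1%:Z - k%:Z)) ?(eq_f (j%:Z - k.+1%:Z) (j.+1%:Z - k.+2%:Z));
  try lia.
rewrite (eq_f (j%:Z + k.+1%:Z + 1) (j.+1%:Z + k%:Z + 1))
  ?(eq_f (j.+2%:Z + k.+1%:Z + 1) (j.+1%:Z + k.+2%:Z + 1)); try lia.
ring.
Qed.

Lemma size_cheb j : (size (chebT j) <= j.+1)%N /\ (size (chebQ j) <= j.+1)%N.
Proof.
elim: j => [|j [IT IQ]]; first by rewrite /chebT /chebQ /= size_poly1.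
have hT : (size (chebT j.+1) <= j.+2)%N.
  rewrite chebTS (leq_trans (size_polyD _ _)) // geq_max size_polyN (leqW IT) andbT.
  rewrite -mulrA mul_polyC (leq_trans (size_scale_leq _ _)) //.
  rewrite (leq_trans (size_polyMleq _ _)) //.
  have : (size (1 - 'X : {poly F})%R <= 2)%N.
    by rewrite (leq_trans (size_polyD _ _)) // size_polyN size_polyX size_poly1.
  by move: IQ; lia.
split=> //; rewrite chebQS (leq_trans (size_polyD _ _)) // geq_max size_polyN (leqW IQ) andbT.
by rewrite mul_polyC (leq_trans (size_scale_leq _ _)).
Qed.

Lemma coef_chebQ j : (chebQ j)`_j = (- 4) ^+ j.
Proof.
elim: j => [|j IH]; first by rewrite /chebQ /= coef1.
have [hT hQ] := size_cheb j.
have tT : (chebT j)`_j.+1 = 0 by apply: nth_default.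
have tQ : (chebQ j)`_j.+1 = 0 by apply: nth_default.
rewrite chebQS coefB coefCM chebTS coefB -mulrA coefCM mulrBl mul1r coefB.
by rewrite coefXM /= IH tT tQ exprS; ring.
Qed.

(** Bases are changed separately on the two sides of the Gram matrix: the
    coefficient matrices multiply the Hankel matrix of the moments. *)
Lemma det_gram_change n (w : {poly F}) (p q : nat -> {poly F}) :
    (forall k, (k < n)%N -> (size (p k) <= n)%N) ->
    (forall k, (k < n)%N -> (size (q k) <= n)%N) ->
  \det (\matrix_(j < n, k < n) L (w * p j * q k)) =
  \det (\matrix_(j < n, i < n) (p j)`_i) * \det (\matrix_(j < n, i < n) (q j)`_i) *
  \det (\matrix_(j < n, k < n) L (w * 'X^(j + k))).
Proof.
move=> hp hq; rewrite -[\det (\matrix_(j < n, i < n) (q j)`_i)]det_tr.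
rewrite mulrAC -!det_mulmx; congr (\det _); apply/matrixP => j k; rewrite !mxE.
have pE (r : nat -> {poly F}) (i : 'I_n) : (size (r i) <= n)%N ->
    r i = \sum_(l < n) ((r i)`_l)%:P * 'X^l.
  move=> h; rewrite -{1}[r i]coefK poly_def (big_ord_widen n (fun l => (r i)`_l *: 'X^l)) //.
  rewrite big_mkcond /=; apply: eq_bigr => l _; rewrite mul_polyC; case: ltnP => // g.
  by rewrite nth_default ?scale0r.
rewrite (pE p j (hp _ (ltn_ord _))) (pE q k (hq _ (ltn_ord _))).
rewrite mulr_sumr raddf_sum /=; apply: eq_bigr => l _.
rewrite [w * _]mulr_sumr mulr_suml raddf_sum /= !mxE mulr_suml; apply: eq_bigr => m _.
rewrite !mxE [_ * (q k)`_l]mulrC -!jacLM exprD; congr (L _); ring.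
Qed.

(** The k-th entry of a row is a monic polynomial of degree k in the row index j,
    so the determinant is that of Vandermonde at 0, 1, ..., n - 1. *)
Lemma det_vandermonde_rising n (x : F) :
  \det (\matrix_(j < n, k < n) rising (x + j%:R) k) = \prod_(j < n) (j`!)%:R.
Proof.
pose r k : {poly F} := \prod_(i < k) ('X - (- (x + i%:R))%:P).
have hr k : (size (r k) <= k.+1)%N by rewrite /r size_prod_XsubC [index_enum _]unlock -enumT size_enum_ord.
have cr k : (r k)`_k = 1.
  have /monicP := monic_prod_XsubC (index_enum 'I_k) (fun=> true) (fun i : 'I_k => - (x + i%:R)).
  by rewrite /r lead_coefE size_prod_XsubC [index_enum _]unlock -enumT size_enum_ord.
have -> : \matrix_(j < n, k < n) rising (x + j%:R) k =
   (Vandermonde n (\row_(j < n) j%:R))^T *m (\matrix_(k < n, i < n) (r k)`_i)^T.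
  apply/matrixP => j k; rewrite !mxE.
  transitivity ((r k).[j%:R]).
    rewrite /r horner_prod /rising; apply: eq_bigr => i _; rewrite hornerXsubC; ring.
  rewrite (horner_coef_wide _ (leq_trans (hr k) (ltn_ord k))).
  by apply: eq_bigr => i _; rewrite !mxE mulrC.
rewrite det_mulmx !det_tr det_Vandermonde det_trig; last first.
  by apply/is_trig_mxP => i j ij; rewrite mxE nth_default // (leq_trans (hr i)).
rewrite [X in _ * X]big1 ?mulr1; last by move=> i _; rewrite mxE cr.
(* Grouped by the larger index j, the differences j - i multiply to j!. *)
rewrite (exchange_big_dep xpredT) //=; apply: eq_bigr => j _.
have hj : (j <= n)%N by apply: ltnW.
transitivity (\prod_(i < n | (i < j)%N) ((j - i)%N%:R : F)).
  by apply: eq_bigr => i ij; rewrite !mxE natrB // ltnW.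
rewrite -(big_ord_widen_cond n xpredT (fun i => (j - i)%N%:R : F) hj) -natr_prod.
congr (_%:R); rewrite fact_prod big_add1 big_mkord (reindex_inj rev_ord_inj) /=.
by apply: eq_bigr => i _; rewrite subKn.
Qed.

(** On the right-hand side the monomials are traded for the unitriangular basis
    s^k (1 - s)^(n - 1 - k). The Beta integrals then have a denominator that only
    depends on the row, and what is left is a Vandermonde determinant. *)
Lemma det_jacobi_moments n :
  \det (\matrix_(j < n, k < n) L (2%:P * (1 - 'X) * 'X^(j + k))) =
  \prod_(j < n) (2 * f 0 * rising (a + 2^-1) j * rising 2^-1 j.+1 * (j`!)%:R / rising (a + 1) (j + n)).
Proof.
pose q k : {poly F} := 'X^k * (1 - 'X) ^+ (n - k.+1).
have s1X : size (1 - 'X : {poly F})%R = 2%N.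
  by rewrite -opprB size_polyN -polyC1 size_XsubC.
have hq k : (k < n)%N -> (size (q k) <= n)%N.
  move=> kn; rewrite /q (leq_trans (size_polyMleq _ _)) // size_polyXn.
  have := size_exp_leq (1 - 'X : {poly F})%R (n - k.+1); rewrite s1X mul1n.
  by case: (size _) => [|m]; lia.
have cq k : (q k)`_k = 1.
  by rewrite /q coefXnM ltnn subnn -horner_coef0 horner_exp !hornerE subr0 expr1n.
have cq0 k i : (i < k)%N -> (q k)`_i = 0 by move=> ik; rewrite /q coefXnM ik.
have := det_gram_change (2%:P * (1 - 'X)) (p := fun j => 'X^j) (q := q) (n := n).
have -> : \det (\matrix_(j < n, i < n) ('X^j : {poly F})`_i) = 1.
  rewrite det_trig; last first.
    by apply/is_trig_mxP => i j ij; rewrite mxE coefXn gtn_eqF.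
  by rewrite big1 // => i _; rewrite mxE coefXn eqxx.
have -> : \det (\matrix_(j < n, i < n) (q j)`_i) = 1.
  rewrite -det_tr det_trig; last first.
    by apply/is_trig_mxP => i j ij; rewrite !mxE cq0.
  by rewrite big1 // => i _; rewrite !mxE cq.
rewrite !mul1r => <- //; last by move=> k kn; rewrite size_polyXn.
pose d1 := \row_(j < n) (2 * f 0 * rising (a + 2^-1) j / rising (a + 1) (j + n)).
pose d2 := \row_(k < n) rising (2^-1 : F) (n - k).
have -> : \matrix_(j < n, k < n) L (2%:P * (1 - 'X) * 'X^j * q k) =
   diag_mx d1 *m \matrix_(j < n, k < n) rising (a + 2^-1 + j%:R) k *m diag_mx d2.
  apply/matrixP => j k; rewrite mul_diag_mx mul_mx_diag !mxE.
  have kn := ltn_ord k; have jn := ltn_ord j.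
  have -> : 2%:P * (1 - 'X) * 'X^j * q k = 2%:P * ('X^(j + k) * (1 - 'X) ^+ (n - k)).
    rewrite /q; have -> : (n - k = (n - k.+1).+1)%N by lia.
    by rewrite exprS exprD; ring.
  rewrite jacLM jacL_beta // risingD; have -> : (j + k + (n - k) = j + n)%N by lia.
  ring.
rewrite !det_mulmx !det_diag det_vandermonde_rising.
have -> : \prod_(i < n) d2 0 i = \prod_(j < n) rising 2^-1 j.+1.
  rewrite (reindex_inj rev_ord_inj) /=; apply: eq_bigr => i _; rewrite mxE.
  by congr (rising _ _) => /=; have := ltn_ord i; lia.
rewrite -!big_split /=; apply: eq_bigr => j _; rewrite mxE; ring.
Qed.

Lemma det_toeplitz_hankel_rising n :
  \det (\matrix_(j < n, k < n) (f (j%:Z - k%:Z) + f (j%:Z + k%:Z + 1))) =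
  \prod_(j < n) (16 ^+ j * (2 * f 0 * rising (a + 2^-1) j * rising 2^-1 j.+1 * (j`!)%:R
     / rising (a + 1) (j + n))).
Proof.
have -> : \matrix_(j < n, k < n) (f (j%:Z - k%:Z) + f (j%:Z + k%:Z + 1)) =
   \matrix_(j < n, k < n) L (2%:P * (1 - 'X) * chebQ j * chebQ k).
  by apply/matrixP => j k; rewrite !mxE jacL_gram.
have hq k : (k < n)%N -> (size (chebQ k) <= n)%N.
  by move=> kn; rewrite (leq_trans (size_cheb k).2).
rewrite (det_gram_change _ hq hq) det_jacobi_moments det_trig; last first.
  by apply/is_trig_mxP => i j ij; rewrite mxE nth_default // (leq_trans (size_cheb i).2).
rewrite -!big_split /=; apply: eq_bigr => j _; rewrite mxE coef_chebQ; congr (_ * _).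
by rewrite -exprMn; congr (_ ^+ _); ring.
Qed.
End Gram.

(** Gamma(k + 1 + a) / (Gamma(1 + a) k!). *)
Definition ratioB a k := \prod_(i < k) (1 + a / (i.+1)%:R).
(** The analogue of [ratioB] with 1 replaced by 1/2. *)
Definition ratioH a k := \prod_(i < k) (1 + a / (i%:R + 2^-1)).

Lemma half_neq0 (i : nat) : 2^-1 + i%:R != 0 :> F.
Proof. by apply: lt0r_neq0; rewrite ltr_wpDr ?invr_gt0 ?ltr0n ?ler0n. Qed.

Lemma ratioBE a k : ratioB a k = rising (a + 1) k / (k`!)%:R.
Proof.
elim: k => [|k IH]; first by rewrite /ratioB big_ord0 rising0 divr1.
rewrite /ratioB big_ord_recr /= -/(ratioB a k) IH risingS factS natrM.
have h : k.+1%:R != 0 :> F by rewrite pnatr_eq0.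
have h2 : (k`!)%:R != 0 :> F by rewrite pnatr_eq0 -lt0n fact_gt0.
by rewrite -natr1 in h *; field; rewrite h h2.
Qed.

Lemma ratioHE a k : ratioH a k = rising (a + 2^-1) k / rising 2^-1 k.
Proof.
elim: k => [|k IH]; first by rewrite /ratioH big_ord0 !rising0 divr1.
rewrite /ratioH big_ord_recr /= -/(ratioH a k) IH !risingS.
have h := half_neq0 k; have h2 := rising_neq0 k half_neq0.
have -> : 1 + a / (k%:R + 2^-1) = (a + 2^-1 + k%:R) / (2^-1 + k%:R).
  rewrite [k%:R + _]addrC -[a + _ + _]addrA; move: h; set d := 2^-1 + _ => h.
  by rewrite [RHS]mulrDl divff // addrC.
by rewrite mulf_div.
Qed.

Lemma fact_double k : ((k.*2)`!)%:R = 4 ^+ k * (k`!)%:R * rising 2^-1 k :> F.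
Proof.
elim: k => [|k IH]; first by rewrite rising0 !mulr1.
rewrite doubleS !factS !natrM IH exprS risingS -addnn -!natr1 natrD; by field.
Qed.

(** The general term of the product is the quotient of two consecutive
    determinants; it tends to 1, which is why the product is arranged in this way. *)
Lemma det_toeplitz_hankel_ratio a (f : int -> F) n :
    (forall i : nat, a + 1 + i%:R != 0) ->
    (forall k : int, f (- k) = f k) ->
    (forall k : int, (a - k%:~R) * f k + (a + k%:~R + 1) * f (k + 1) = 0) ->
  \det (\matrix_(j < n, k < n) (f (j%:Z - k%:Z) + f (j%:Z + k%:Z + 1))) =
  \prod_(k < n) (f 0 * (ratioH a k * ratioB a k / (ratioB a k.*2 * ratioB a k.*2.+1))).
Proof.
move=> ha f_even f_rec; rewrite (det_toeplitz_hankel_rising ha f_even f_rec).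
have hR m := rising_a1_neq0 ha m.
pose c j := 16 ^+ j * (2 * f 0 * rising (a + 2^-1) j * rising 2^-1 j.+1 * (j`!)%:R).
have cE m : \prod_(j < m) (16 ^+ j * (2 * f 0 * rising (a + 2^-1) j * rising 2^-1 j.+1 * (j`!)%:R
     / rising (a + 1) (j + m))) = (\prod_(j < m) c j) / \prod_(j < m) rising (a + 1) (j + m).
  by rewrite -prodfV -big_split /=; apply: eq_bigr => j _; rewrite /c !mulrA.
(* The denominators for n and n + 1 are the rising factorials of lengths
   n, ..., 2n - 1 and n + 1, ..., 2n + 1. *)
have step m : rising (a + 1) m * \prod_(j < m.+1) rising (a + 1) (j + m.+1) =
     \prod_(j < m) rising (a + 1) (j + m) * (rising (a + 1) m.*2 * rising (a + 1) m.*2.+1).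
  transitivity (\prod_(j < m.+2) rising (a + 1) (j + m)).
    rewrite [RHS]big_ord_recl /=; congr (_ * _); apply: eq_bigr => j _.
    by rewrite addSnnS.
  by rewrite !big_ord_recr /= addSn addnn mulrA.
rewrite cE; elim: n => [|n IH]; first by rewrite !big_ord0 divr1.
rewrite [RHS]big_ord_recr /= -IH big_ord_recr /=.
have hP m k : \prod_(j < m) rising (a + 1) (j + k) != 0 by apply/prodf_neq0.
have := step n => /(canRL (mulKf (hR n))) ->.
rewrite !ratioBE !ratioHE factS natrM fact_double /c risingS.
have h := rising_neq0 n half_neq0.
have h2 : (n`!)%:R != 0 :> F by rewrite pnatr_eq0 -lt0n fact_gt0.
have -> : n.*2.+1%:R = 2 * (2^-1 + n%:R) :> F by rewrite -natr1 -addnn natrD; field.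
have -> : 16 ^+ n = 4 ^+ n * 4 ^+ n :> F by rewrite -exprMn; congr (_ ^+ _); ring.
have h4 : 4 ^+ n != 0 :> F by rewrite expf_neq0 ?pnatr_eq0.
have h5 : 1 + n%:R * 2 != 0 :> F by rewrite lt0r_neq0 // ltr_wpDr ?mulr_ge0 ?ler0n ?ltr01.
by field; rewrite ?hR ?hP ?h ?h2 ?h4 ?h5.
Qed.
End JacobiFunctional.

(** * Complex modulus, exponential and derivatives along a real variable *)
Section ComplexBasics.
Variable R : realType.
Implicit Types (x y z w : R[i]) (a b c t : R).

Lemma cReD z w : complex.Re (z + w) = complex.Re z + complex.Re w.
Proof. by case: z w => [? ?] [? ?]. Qed.
Lemma cImD z w : complex.Im (z + w) = complex.Im z + complex.Im w.
Proof. by case: z w => [? ?] [? ?]. Qed.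
Lemma cReN z : complex.Re (- z) = - complex.Re z. Proof. by case: z. Qed.
Lemma cImN z : complex.Im (- z) = - complex.Im z. Proof. by case: z. Qed.
Lemma cReB z w : complex.Re (z - w) = complex.Re z - complex.Re w.
Proof. by rewrite cReD cReN. Qed.
Lemma cImB z w : complex.Im (z - w) = complex.Im z - complex.Im w.
Proof. by rewrite cImD cImN. Qed.
Lemma cReM z w : complex.Re (z * w) =
  complex.Re z * complex.Re w - complex.Im z * complex.Im w.
Proof. by case: z w => [? ?] [? ?]. Qed.
Lemma cImM z w : complex.Im (z * w) =
  complex.Re z * complex.Im w + complex.Im z * complex.Re w.
Proof. by case: z w => [? ?] [? ?]. Qed.
Lemma cReMr a z : complex.Re (a%:C * z) = a * complex.Re z.
Proof. by rewrite cReM mul0r subr0. Qed.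
Lemma cReV z : complex.Re z^-1 =
  complex.Re z / (complex.Re z ^+ 2 + complex.Im z ^+ 2).
Proof. by case: z. Qed.
Lemma cImV z : complex.Im z^-1 =
  - complex.Im z / (complex.Re z ^+ 2 + complex.Im z ^+ 2).
Proof. by case: z => a b /=; rewrite mulNr. Qed.
Lemma natrC n : (n%:R : R)%:C = n%:R :> R[i].
Proof. by rewrite (rmorph_nat (real_complex R)). Qed.
Lemma cRe_nat n : complex.Re (n%:R : R[i]) = n%:R.
Proof. by rewrite -natrC. Qed.
Lemma eqC_ReIm z w : complex.Re z = complex.Re w -> complex.Im z = complex.Im w -> z = w.
Proof. by case: z w => [? ?] [? ?] /= -> ->. Qed.

Lemma normc_ge0 z : 0 <= normc z. Proof. by case: z => a b; apply: sqrtr_ge0. Qed.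
Lemma normc_sqr z : normc z ^+ 2 = complex.Re z ^+ 2 + complex.Im z ^+ 2.
Proof. by case: z => a b /=; rewrite sqr_sqrtr // addr_ge0 ?sqr_ge0. Qed.
Lemma normcR a : normc a%:C = `|a|.
Proof. by rewrite /= expr0n addr0 sqrtr_sqr. Qed.
Lemma normc_nat n : normc (n%:R : R[i]) = n%:R.
Proof. by rewrite -natrC normcR ger0_norm. Qed.
Lemma normc_eq0 z : (normc z == 0) = (z == 0).
Proof. by apply/eqP/eqP => [/eq0_normc//|->]; rewrite normc0. Qed.
Lemma normc_gt0 z : (0 < normc z) = (z != 0).
Proof. by rewrite lt_def normc_ge0 andbT normc_eq0. Qed.
Lemma le_Re_normc z : `|complex.Re z| <= normc z.
Proof.
rewrite -(ler_pXn2r (ltn0Sn 1)) ?nnegrE ?normc_ge0 //.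
by rewrite normc_sqr real_normK ?num_real // lerDl sqr_ge0.
Qed.
Lemma le_Im_normc z : `|complex.Im z| <= normc z.
Proof.
rewrite -(ler_pXn2r (ltn0Sn 1)) ?nnegrE ?normc_ge0 //.
by rewrite normc_sqr real_normK ?num_real // lerDr sqr_ge0.
Qed.
Lemma normcD z w : normc (z + w) <= normc z + normc w.
Proof. exact: le_normcD. Qed.
Lemma normcB z w : normc (z - w) <= normc z + normc w.
Proof. by rewrite -(normcN w) normcD. Qed.
Lemma normc_dist z w : normc (z - w) = normc (w - z).
Proof. by rewrite -opprB normcN. Qed.
Lemma normc_le_ReIm z : normc z <= `|complex.Re z| + `|complex.Im z|.
Proof.
rewrite {1}[z]complexE (le_trans (normcD _ _)) // normcM !normcR.
by rewrite /= expr0n expr1n add0r sqrtr1 mul1r.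
Qed.
Lemma normcX z n : normc (z ^+ n) = normc z ^+ n.
Proof. by elim: n => [|n IH]; rewrite ?expr0 ?normc1 // !exprS normcM IH. Qed.

Lemma expC0 : expC (0 : R[i]) = 1.
Proof. by rewrite /expC /= expR0 cos0 sin0 mul1r. Qed.
Lemma expCD z w : expC (z + w) = expC z * expC w.
Proof.
rewrite /expC cReD cImD expRD; apply: eqC_ReIm; rewrite ?(cReM, cImM) /= cosD sinD; ring.
Qed.
Lemma expCNV z : expC (- z) * expC z = 1.
Proof. by rewrite -expCD addNr expC0. Qed.
Lemma expC_neq0 z : expC z != 0.
Proof. by apply: contra_eq_neq (expCNV z) => ->; rewrite mulr0 eq_sym oner_eq0. Qed.
Lemma expCN z : expC (- z) = (expC z)^-1.
Proof. by rewrite -[LHS]mulr1 -(divff (expC_neq0 z)) mulrA expCNV mul1r. Qed.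
Lemma expCB z w : expC (z - w) = expC z / expC w.
Proof. by rewrite expCD expCN. Qed.
Lemma expC_sum (I : Type) (r : seq I) (P : pred I) (F : I -> R[i]) :
  expC (\sum_(i <- r | P i) F i) = \prod_(i <- r | P i) expC (F i).
Proof. by apply: (big_morph _ expCD); rewrite expC0. Qed.
Lemma expC_natM n z : expC (n%:R * z) = expC z ^+ n.
Proof.
elim: n => [|n IH]; first by rewrite mul0r expC0.
by rewrite -natr1 mulrDl mul1r expCD IH exprSr.
Qed.
Lemma expCR a : expC a%:C = (expR a)%:C.
Proof. by rewrite /expC /= cos0 sin0 mulr1. Qed.
Lemma normc_expC z : normc (expC z) = expR (complex.Re z).
Proof.
by rewrite /expC normcM normcR ger0_norm ?expR_ge0 //= cos2Dsin2 sqrtr1 mulr1.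
Qed.
Lemma normc_expC_le z : normc (expC z) <= expR (normc z).
Proof. by rewrite normc_expC ler_expR (le_trans (ler_norm _)) // le_Re_normc. Qed.
Lemma cisE t : cis t = expC (0 +i* t).
Proof. by rewrite /expC /= expR0 mul1r. Qed.
Lemma cisD a b : cis (a + b) = cis a * cis b.
Proof. by rewrite !cisE -expCD; congr expC; apply: eqC_ReIm; rewrite /= ?addr0. Qed.
Lemma normc_cis t : normc (cis t) = 1.
Proof. by rewrite cisE normc_expC /= expR0. Qed.

(** Componentwise, so that the calculus of real derivatives applies. *)
Definition is_deriveC (g : R -> R[i]) (t : R) (d : R[i]) :=
  is_derive t 1 (fun s => complex.Re (g s)) (complex.Re d) /\
  is_derive t 1 (fun s => complex.Im (g s)) (complex.Im d).

Lemma is_deriveC_eq g t d d' : is_deriveC g t d -> d = d' -> is_deriveC g t d'.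
Proof. by move=> h <-. Qed.

Lemma is_deriveC_cst z t : is_deriveC (fun=> z) t 0.
Proof. by split; apply: is_derive_cst. Qed.

Lemma is_deriveC_real (g : R -> R) t d : is_derive t 1 g d ->
  is_deriveC (fun s => (g s)%:C) t d%:C.
Proof. by move=> h; split => //=; apply: is_derive_cst. Qed.

Lemma is_deriveCD f g t d e : is_deriveC f t d -> is_deriveC g t e ->
  is_deriveC (fun s => f s + g s) t (d + e).
Proof.
move=> [f1 f2] [g1 g2]; split; rewrite ?cReD ?cImD.
- rewrite [X in is_derive _ _ X _](_ : _ = (fun s => complex.Re (f s)) + (fun s => complex.Re (g s))).
    exact: is_deriveD.
  by apply/funext => s; rewrite cReD.
- rewrite [X in is_derive _ _ X _](_ : _ = (fun s => complex.Im (f s)) + (fun s => complex.Im (g s))).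
    exact: is_deriveD.
  by apply/funext => s; rewrite cImD.
Qed.

Lemma is_deriveCM f g t d e : is_deriveC f t d -> is_deriveC g t e ->
  is_deriveC (fun s => f s * g s) t (d * g t + f t * e).
Proof.
move=> [f1 f2] [g1 g2].
set fr := fun s => complex.Re (f s) in f1; set fi := fun s => complex.Im (f s) in f2.
set gr := fun s => complex.Re (g s) in g1; set gi := fun s => complex.Im (g s) in g2.
split.
- rewrite [X in is_derive _ _ X _](_ : _ = fr * gr - fi * gi); last first.
    by apply/funext => s; rewrite cReM.
  apply: is_derive_eq; rewrite cReD !cReM /GRing.scale /= /fr /fi /gr /gi; ring.
- rewrite [X in is_derive _ _ X _](_ : _ = fr * gi + fi * gr); last first.
    by apply/funext => s; rewrite cImM.
  apply: is_derive_eq; rewrite cImD !cImM /GRing.scale /= /fr /fi /gr /gi; ring.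
Qed.

Lemma is_deriveC_exp f t d : is_deriveC f t d ->
  is_deriveC (fun s => expC (f s)) t (d * expC (f t)).
Proof.
move=> [f1 f2].
set fr := fun s => complex.Re (f s) in f1; set fi := fun s => complex.Im (f s) in f2.
have d1 : is_derive t 1 (expR \o fr) (expR (fr t) * complex.Re d) by apply: is_derive1_comp.
have d2 : is_derive t 1 (cos \o fi) (- sin (fi t) * complex.Im d) by apply: is_derive1_comp.
have d3 : is_derive t 1 (sin \o fi) (cos (fi t) * complex.Im d) by apply: is_derive1_comp.
split.
- rewrite [X in is_derive _ _ X _](_ : _ = (expR \o fr) * (cos \o fi)); last first.
    by apply/funext => s; rewrite /expC cReM /= mul0r subr0.
  apply: is_derive_eq; rewrite /expC !cReM !cImM /GRing.scale /= /fr /fi; ring.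
- rewrite [X in is_derive _ _ X _](_ : _ = (expR \o fr) * (sin \o fi)); last first.
    by apply/funext => s; rewrite /expC cImM /= mul0r addr0.
  apply: is_derive_eq; rewrite /expC !cImM !cReM /GRing.scale /= /fr /fi; ring.
Qed.

Lemma le_increment_dominated (g h dg dh : R -> R) a b : a <= b ->
  (forall t, a <= t <= b -> is_derive t 1 g (dg t)) ->
  (forall t, a <= t <= b -> is_derive t 1 h (dh t)) ->
  (forall t, a <= t <= b -> dg t <= dh t) ->
  g b - g a <= h b - h a.
Proof.
move=> ab Dg Dh gh.
have D t : a <= t <= b -> is_derive t 1 (h - g) (dh t - dg t).
  by move=> tab; have := Dg t tab; have := Dh t tab => *; apply: is_deriveB.
have [||c] := @MVT_segment R (h - g) (fun t => dh t - dg t) a b ab.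
- by move=> t; rewrite in_itv /= => /andP[at_ tb]; apply: D; rewrite !ltW.
- apply: derivable_within_continuous => t; rewrite in_itv /= => tab.
  by have [] := D t tab.
rewrite in_itv /= => cab E.
rewrite -subr_ge0 (_ : _ - _ - _ = (h - g) b - (h - g) a); last by rewrite /= !fctE; ring.
by rewrite E mulr_ge0 ?subr_ge0 // gh.
Qed.

(** A mean value inequality with a variable bound dh. The factor 2 comes from
    estimating the real and imaginary parts separately. *)
Lemma normc_increment_le (g dg : R -> R[i]) (h dh : R -> R) a b : a <= b ->
  (forall t, a <= t <= b -> is_deriveC g t (dg t)) ->
  (forall t, a <= t <= b -> is_derive t 1 h (dh t)) ->
  (forall t, a <= t <= b -> normc (dg t) <= dh t) ->
  normc (g b - g a) <= 2 * (h b - h a).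
Proof.
move=> ab Dg Dh gh.
have absP (k dk : R -> R) : (forall t, a <= t <= b -> is_derive t 1 k (dk t)) ->
    (forall t, a <= t <= b -> `|dk t| <= dh t) -> `|k b - k a| <= h b - h a.
  move=> Dk kh; rewrite ler_norml; apply/andP; split; last first.
    apply: (@le_increment_dominated k h dk dh) => // t tab.
    by rewrite (le_trans (ler_norm _)) ?kh.
  rewrite lerNl -[leLHS]/(- (k b - k a)) (_ : - (k b - k a) = (- k) b - (- k) a); last first.
    by rewrite !fctE; ring.
  apply: (@le_increment_dominated (- k) h (- dk) dh) => // t tab.
    by have := Dk t tab => ?; apply: is_deriveN.
  by rewrite (le_trans _ (kh t tab)) // -normrN ler_norm.
rewrite (le_trans (normc_le_ReIm _)) // mulrDl mul1r cReB cImB; apply: lerD.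
- apply: (absP (fun s => complex.Re (g s)) (fun s => complex.Re (dg s))) => t tab.
    exact: (Dg t tab).1.
  by rewrite (le_trans (le_Re_normc _)) ?gh.
- apply: (absP (fun s => complex.Im (g s)) (fun s => complex.Im (dg s))) => t tab.
    exact: (Dg t tab).2.
  by rewrite (le_trans (le_Im_normc _)) ?gh.
Qed.

End ComplexBasics.

(** * Limits of complex sequences *)
Section ComplexLimits.
Variable R : realType.
Implicit Types (u v : nat -> R[i]) (z w l : R[i]) (a b c t : R).

(** Convergence of both components; [cvgC_limn] and [equiv_of_ratio] translate it
    into the topology of the plane. *)
Definition cvgC u l :=
  (fun n => complex.Re (u n)) @ \oo --> complex.Re l /\
  (fun n => complex.Im (u n)) @ \oo --> complex.Im l.

Lemma cvgC_cst l : cvgC (fun=> l) l.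
Proof. by split; apply: cvg_cst. Qed.

Lemma cvgCD u v l m : cvgC u l -> cvgC v m -> cvgC (fun n => u n + v n) (l + m).
Proof.
move=> [u1 u2] [v1 v2]; split; rewrite ?cReD ?cImD.
- by under eq_fun do rewrite cReD; apply: cvgD.
- by under eq_fun do rewrite cImD; apply: cvgD.
Qed.

Lemma cvgCM u v l m : cvgC u l -> cvgC v m -> cvgC (fun n => u n * v n) (l * m).
Proof.
move=> [u1 u2] [v1 v2]; split; rewrite ?cReM ?cImM.
- by under eq_fun do rewrite cReM; apply: cvgB; apply: cvgM.
- by under eq_fun do rewrite cImM; apply: cvgD; apply: cvgM.
Qed.

Lemma cvgCN u l : cvgC u l -> cvgC (fun n => - u n) (- l).
Proof.
move=> h; rewrite -mulN1r; under eq_fun do rewrite -mulN1r.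
exact: cvgCM (cvgC_cst _) h.
Qed.

Lemma cvgCB u v l m : cvgC u l -> cvgC v m -> cvgC (fun n => u n - v n) (l - m).
Proof. by move=> h1 h2; apply: cvgCD => //; apply: cvgCN. Qed.

Lemma cvgCX u l k : cvgC u l -> cvgC (fun n => u n ^+ k) (l ^+ k).
Proof.
move=> h; elim: k => [|k IH]; first by under eq_fun do rewrite expr0; apply: cvgC_cst.
by rewrite exprS; under eq_fun do rewrite exprS; apply: cvgCM.
Qed.

Lemma cvgCV u l : l != 0 -> cvgC u l -> cvgC (fun n => (u n)^-1) l^-1.
Proof.
move=> l0 [u1 u2].
have n0 : complex.Re l ^+ 2 + complex.Im l ^+ 2 != 0.
  by rewrite -normc_sqr expf_neq0 // normc_eq0.
have cn : (fun n => complex.Re (u n) ^+ 2 + complex.Im (u n) ^+ 2) @ \oo -->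
    complex.Re l ^+ 2 + complex.Im l ^+ 2 by apply: cvgD; apply: cvgM.
split; rewrite ?cReV ?cImV.
- by under eq_fun do rewrite cReV; apply: cvgM => //; apply: cvgV.
- by under eq_fun do rewrite cImV; apply: cvgM; [apply: cvgN | apply: cvgV].
Qed.

Lemma cvgC_expC u l : cvgC u l -> cvgC (fun n => expC (u n)) (expC l).
Proof.
move=> [u1 u2]; have hE := cvg_comp _ _ u1 (@continuous_expR R (complex.Re l)).
have hc := cvg_comp _ _ u2 (@continuous_cos R (complex.Im l)).
have hs := cvg_comp _ _ u2 (@continuous_sin R (complex.Im l)).
rewrite /expC; apply: cvgCM; split => //=; exact: cvg_cst.
Qed.

Lemma cvgC_real (f : nat -> R) a : f @ \oo --> a -> cvgC (fun n => (f n)%:C) a%:C.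
Proof. by move=> h; split => //=; apply: cvg_cst. Qed.

Lemma cvgC_eps u l : cvgC u l <->
  forall e : R, 0 < e -> exists N : nat, forall n, (N <= n)%N -> normc (u n - l) <= e.
Proof.
split=> [[u1 u2] e e0|h].
- have e2 : 0 < e / 2 by rewrite divr_gt0.
  have [N1 _ h1] := ((cvgrPdist_le _ _).1 u1 (e / 2) e2).
  have [N2 _ h2] := ((cvgrPdist_le _ _).1 u2 (e / 2) e2).
  exists (maxn N1 N2) => n; rewrite geq_max => /andP[n1 n2].
  rewrite (le_trans (normc_le_ReIm _)) // cReB cImB [e]splitr distrC [X in _ + X]distrC.
  by apply: lerD; [apply: h1 | apply: h2].
- split; apply/cvgrPdist_le => e /h[N hN]; exists N => // n /= /hN H.
    by rewrite -normrN opprB -cReB (le_trans (le_Re_normc _)).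
  by rewrite -normrN opprB -cImB (le_trans (le_Im_normc _)).
Qed.

Lemma cvgC_squeeze u l (b : nat -> R) (N : nat) :
  (forall n, (N <= n)%N -> normc (u n - l) <= b n) -> b @ \oo --> (0 : R) -> cvgC u l.
Proof.
move=> h /cvgrPdist_le hb; apply/cvgC_eps => e /hb[M _ hM].
exists (maxn N M) => n; rewrite geq_max => /andP[n1 n2].
rewrite (le_trans (h n n1)) // (le_trans (ler_norm _)) // -normrN -sub0r.
exact: hM.
Qed.

Lemma cvgC_eq u v l (N : nat) : (forall n, (N <= n)%N -> u n = v n) -> cvgC u l -> cvgC v l.
Proof.
move=> h /cvgC_eps hu; apply/cvgC_eps => e /hu[M hM].
exists (maxn N M) => n; rewrite geq_max => /andP[n1 n2].
by rewrite -h // hM.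
Qed.

Lemma cvgC_unique u l m : cvgC u l -> cvgC u m -> l = m.
Proof.
move=> /cvgC_eps h1 /cvgC_eps h2; apply/eqP; rewrite -subr_eq0 -normc_eq0.
rewrite eq_le normc_ge0 andbT; apply/ler_addgt0Pl => e e0; rewrite addr0.
have e2 : 0 < e / 2 by rewrite divr_gt0.
have [[N hN] [M hM]] := (h1 _ e2, h2 _ e2).
rewrite (_ : l - m = (u (maxn N M) - m) - (u (maxn N M) - l)); last by ring.
by rewrite (le_trans (normcB _ _)) // [e]splitr lerD // ?hN ?hM ?leq_maxl ?leq_maxr.
Qed.

Lemma cvgC_sub u l (f : nat -> nat) : (forall n, (n <= f n)%N) -> cvgC u l ->
  cvgC (fun n => u (f n)) l.
Proof.
move=> hf /cvgC_eps h; apply/cvgC_eps => e /h[N hN]; exists N => n nN.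
by apply: hN; apply: leq_trans (hf n).
Qed.

Lemma cvgC_invn : cvgC (fun n => (n%:R)^-1) 0.
Proof.
apply: (@cvgC_squeeze _ _ (fun n => (n%:R)^-1) 1).
  by move=> n n0; rewrite subr0 normcV normc_nat.
rewrite -cvg_shiftS /=; exact: cvg_harmonic.
Qed.

Lemma cvgC_limn u l : cvgC u l -> limn (u : nat -> R[i]^o) = l.
Proof.
move=> h; apply: cvg_lim => //; apply/cvgrPdist_le => /= e e0.
have [eI eR] : complex.Im e = 0 /\ 0 < complex.Re e.
  by move: e0; rewrite ltcE => /andP[/eqP -> ].
have eE : e = (complex.Re e)%:C by apply: eqC_ReIm.
have [N hN] := (cvgC_eps u l).1 h _ eR.
exists N => // n /= /hN; rewrite normc_dist => H.
by rewrite eE; move: H; rewrite -lecR; case: (l - u n).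
Qed.

Lemma telescope_le u (K : R) (N : nat) : (0 < N)%N ->
  (forall n, (N <= n)%N -> normc (u n.+1 - u n) <= K * (n%:R^-1 - n.+1%:R^-1)) ->
  forall n m : nat, (N <= n)%N -> (n <= m)%N -> normc (u m - u n) <= K * (n%:R^-1 - m%:R^-1).
Proof.
move=> N0 h n m Nn nm; rewrite -(subnKC nm); elim: (m - n)%N => [|k IH].
  by rewrite addn0 !subrr normc0 mulr0.
rewrite addnS (_ : u (n + k).+1 - u n = (u (n + k).+1 - u (n + k)%N) + (u (n + k)%N - u n)).
  rewrite (le_trans (normcD _ _)) //.
  have := h _ (leq_trans Nn (leq_addr k n)); move: IH.
  move: (normc _) (normc _) (n%:R^-1) ((n + k)%N%:R^-1) ((n + k).+1%:R^-1) => A B x y z; nra.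
by ring.
Qed.

(** Adding K / n to a component makes it monotone and bounded. *)
Lemma cvgC_telescope u (K : R) (N : nat) : (0 < N)%N -> 0 <= K ->
  (forall n, (N <= n)%N -> normc (u n.+1 - u n) <= K * (n%:R^-1 - n.+1%:R^-1)) ->
  exists l, cvgC u l.
Proof.
move=> N0 K0 h; have T := telescope_le N0 h.
have cR (p : R[i] -> R) : (forall z, `|p z| <= normc z) ->
    (forall z w, p (z - w) = p z - p w) -> cvgn (fun n => p (u n)).
  move=> pn pB.
  have dp n m : (N <= n)%N -> (n <= m)%N -> `|p (u m) - p (u n)| <= K * (n%:R^-1 - m%:R^-1).
    by move=> Nn nm; rewrite -pB (le_trans (pn _)) ?T.
  pose a n := p (u (n + N)%N) - K * ((n + N)%N%:R)^-1.
  have a_nd : {homo a : m n / (m <= n)%N >-> m <= n}.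
    move=> n m nm; have := dp (n + N)%N (m + N)%N (leq_addl _ _).
    by rewrite leq_add2r ler_norml /a => /(_ nm) /andP[]; lra.
  have a_ub : has_ubound (range a).
    exists (p (u N) + K * (N%:R)^-1) => _ [n _ <-]; rewrite /a.
    have := dp N (n + N)%N (leqnn _) (leq_addl _ _); rewrite ler_norml => /andP[_].
    have : 0 <= K * ((n + N)%N%:R)^-1 by rewrite mulr_ge0.
    by lra.
  have ca := nondecreasing_is_cvgn a_nd a_ub.
  have ci : (fun n => K * ((n + N)%N%:R)^-1) @ \oo --> K * 0.
    apply: cvgM; first exact: cvg_cst.
    rewrite (cvg_shiftn N (fun n => (n%:R)^-1 : R)) -cvg_shiftS /=; exact: cvg_harmonic.
  apply/cvg_ex; exists (limn a + K * 0); rewrite -(cvg_shiftn N).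
  rewrite (_ : (fun _ => _) = (fun n => a n + K * ((n + N)%N%:R)^-1)); first exact: cvgD.
  by apply/funext => n; rewrite /a subrK.
have c1 := cR (@complex.Re R) (@le_Re_normc R) (@cReB R).
have c2 := cR (@complex.Im R) (@le_Im_normc R) (@cImB R).
by exists (limn (fun n => complex.Re (u n)) +i* limn (fun n => complex.Im (u n))); split.
Qed.

(** The Stolz--Cesaro rule in the form 0/0: the tail of v is compared with the
    telescoping tail of c / n. *)
Lemma cvgC_stolz v (c : R[i]) : cvgC v 0 ->
  cvgC (fun n => n%:R * (n.+1)%:R * (v n - v n.+1)) c -> cvgC (fun n => n%:R * v n) c.
Proof.
move=> v0 /cvgC_eps hc; apply/cvgC_eps => e e0; have [N hN] := hc e e0.
exists (maxn N 1) => n; rewrite geq_max => /andP[Nn n0].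
have nz (k : nat) : (0 < k)%N -> k%:R != 0 :> R[i] by rewrite pnatr_eq0 lt0n.
(* The increments of v - c / k are at most e (1 / k - 1 / (k + 1)). *)
pose w k := v k - c / k%:R.
have hw k : (n <= k)%N -> normc (w k.+1 - w k) <= e * (k%:R^-1 - k.+1%:R^-1).
  move=> nk; have k0 := leq_trans n0 nk.
  have -> : w k.+1 - w k = - ((k%:R * k.+1%:R * (v k - v k.+1) - c) / (k%:R * k.+1%:R)).
    by rewrite /w -natr1; field; rewrite natr1 !nz.
  rewrite normcN normcM normcV normcM !normc_nat.
  have -> : k%:R^-1 - k.+1%:R^-1 = (k%:R * k.+1%:R)^-1 :> R.
    have hk : k%:R != 0 :> R by rewrite pnatr_eq0 -lt0n.
    have hk1 : k%:R + 1 != 0 :> R by rewrite natr1 pnatr_eq0.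
    by rewrite -natr1; field; rewrite hk hk1.
  by rewrite ler_wpM2r ?invr_ge0 ?mulr_ge0 ?ler0n // hN // (leq_trans Nn).
have T := telescope_le n0 hw (leqnn n).
have cw : cvgC w 0.
  rewrite -[0](subr0 0) -[X in 0 - X](mulr0 c); apply: cvgCB => //.
  exact: cvgCM (cvgC_cst _) cvgC_invn.
have wn : normc (w n) <= e / n%:R.
  apply/ler_addgt0Pl => d d0; have [M hM] := (cvgC_eps w 0).1 cw d d0.
  pose k := maxn n M.
  rewrite (_ : w n = w k - 0 - (w k - w n)); last by ring.
  rewrite (le_trans (normcB _ _)) // lerD ?hM ?leq_maxr //.
  rewrite (le_trans (T k (leq_maxl _ _))) // mulrBr gerBl.
  by apply: mulr_ge0; [exact: ltW | rewrite invr_ge0].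
rewrite (_ : n%:R * v n - c = n%:R * w n); last by rewrite /w; field; rewrite nz.
rewrite normcM normc_nat -ler_pdivlMl ?ltr0n //.
by rewrite mulrC.
Qed.
End ComplexLimits.

(** * Products with factors close to 1 *)
Section Products.
Variable R : realType.
Implicit Types (z w l : R[i]) (a b c s t : R).

(** The elementary Weierstrass factor of genus 2, which replaces the logarithm
    of 1 + w and avoids its branches. *)
Definition expfac w := (1 + w) * expC (- w + w ^+ 2 / 2).

Definition expfacK : R := 2 * expR 2.

Lemma expfacK_ge0 : 0 <= expfacK.
Proof. by rewrite mulr_ge0 ?expR_ge0. Qed.

Lemma is_derive_linear (k t : R) : is_derive t 1 (fun s => k * s) k.
Proof.
rewrite [X in is_derive _ _ X _](_ : _ = k *: id); last by apply/funext.
by apply: is_derive_eq; rewrite /GRing.scale /= mulr1.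
Qed.

Lemma is_derive_sqr t : is_derive t 1 (fun s : R => s ^+ 2) (2 * t).
Proof.
rewrite [X in is_derive _ _ X _](_ : _ = id * id); last first.
  by apply/funext => s; rewrite expr2.
by apply: is_derive_eq; rewrite /GRing.scale /= ; ring.
Qed.

(** Along the segment from 0 to w, the derivative of
    (1 + t w) exp (- t w + t^2 w^2 / 2) is t^2 w^3 times the exponential: the terms
    of lower order cancel. *)
Lemma normc_expfac_sub1 w : normc w <= 1 -> normc (expfac w - 1) <= expfacK * normc w ^+ 3.
Proof.
move=> w1.
pose g (t : R) := (1 + w * t%:C) * expC (- w * t%:C + w ^+ 2 / 2 * (t ^+ 2)%:C).
pose dg (t : R) := w ^+ 3 * (t ^+ 2)%:C * expC (- w * t%:C + w ^+ 2 / 2 * (t ^+ 2)%:C).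
have Dl z t : is_deriveC (fun s : R => z * s%:C) t z.
  apply: is_deriveC_eq; first apply: is_deriveCM; first exact: is_deriveC_cst.
    by apply: is_deriveC_real; apply: is_derive_id.
  by rewrite mul0r add0r mulr1.
have Dg t : is_deriveC g t (dg t).
  apply: is_deriveC_eq.
    apply: is_deriveCM; first by apply: is_deriveCD; [exact: is_deriveC_cst | exact: Dl].
    apply: is_deriveC_exp; apply: is_deriveCD; first exact: Dl.
    apply: is_deriveCM; first exact: is_deriveC_cst.
    exact: (is_deriveC_real (is_derive_sqr t)).
  rewrite /dg; set E := expC _.
  have -> : (t ^+ 2)%:C = t%:C ^+ 2 :> R[i] by rewrite rmorphXn.
  have -> : (2 * t)%:C = 2 * t%:C :> R[i] by rewrite rmorphM /= natrC.
  by field.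
have -> : expfac w - 1 = g 1 - g 0.
  have E1 : (1 : R)%:C = 1 :> R[i] by [].
  have E0 : (0 : R)%:C = 0 :> R[i] by [].
  by rewrite /g /expfac expr1n expr0n E1 E0 !mulr1 !mulr0 !addr0 expC0 mulr1.
rewrite (le_trans (@normc_increment_le R g dg (fun t => expR 2 * normc w ^+ 3 * t) (fun=> expR 2 * normc w ^+ 3) 0 1 _ _ _ _)) //.
- move=> t _; exact: is_derive_linear.
- move=> t /andP[t0 t1]; rewrite /dg normcM (normcM (w ^+ 3)) normcX mulrC.
  have n0 := normc_ge0 w.
  have t2 : normc (t ^+ 2)%:C <= 1 by rewrite normcR ger0_norm ?sqr_ge0 // expr_le1.
  have -> : expR 2 * normc w ^+ 3 = expR 2 * (normc w ^+ 3 * 1) by rewrite mulr1.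
  apply: ler_pM; rewrite ?normc_ge0 ?mulr_ge0 ?exprn_ge0 ?normc_ge0 //; last first.
    by rewrite ler_wpM2l ?exprn_ge0.
  rewrite (le_trans (normc_expC_le _)) // ler_expR (le_trans (normcD _ _)) //.
  rewrite !(normcM _ _%:C) normcN (normcM (w ^+ 2)) normcV normcX normc_nat.
  have h1 : normc w * normc t%:C <= 1.
    by rewrite mulr_ile1 ?normc_ge0 // normcR ger0_norm.
  have h2 : normc w ^+ 2 / 2 * normc (t ^+ 2)%:C <= 1.
    rewrite mulr_ile1 ?normc_ge0 ?mulr_ge0 ?exprn_ge0 ?invr_ge0 //.
    by rewrite ler_pdivrMr // mul1r (le_trans (exprn_ile1 2 n0 w1)) // ler1n.
  by rewrite -[2%R]/(1 + 1) lerD.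
- by rewrite mulr0 subr0 mulr1 mulrA.
Qed.

Lemma expfacE w : 1 + w = expfac w * expC (w - w ^+ 2 / 2).
Proof.
rewrite /expfac -mulrA -expCD (_ : _ + _ + _ = 0) ?expC0 ?mulr1 //; ring.
Qed.

Lemma expR_le_1D2 s : 0 <= s -> s <= 1 / 2 -> expR s <= 1 + 2 * s.
Proof.
move=> s0 s1; have e0 := expR_gt0 s.
have : 1 - s <= (expR s)^-1 by rewrite -expRN expR_ge1Dx.
rewrite -(ler_pM2r e0) mulVf ?gt_eqF //; nra.
Qed.

Lemma normc_prod_sub1 (I : Type) (r : seq I) (F : I -> R[i]) :
  normc (\prod_(i <- r) F i - 1) <= expR (\sum_(i <- r) normc (F i - 1)) - 1.
Proof.
elim: r => [|i r IH]; first by rewrite !big_nil subrr normc0 expR0 subrr.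
rewrite !big_cons expRD; set P := \prod_(j <- r) _ in IH *; set e := expR _ in IH *.
have -> : F i * P - 1 = (F i - 1) * (P - 1) + (F i - 1) + (P - 1) by ring.
apply: le_trans (normcD _ _) _.
have h1 := expR_ge1Dx (normc (F i - 1)).
have h2 := normcD ((F i - 1) * (P - 1)) (F i - 1).
rewrite normcM in h2; have h3 := normc_ge0 (F i - 1); have h4 := normc_ge0 (P - 1).
have h5 : (1 + normc (F i - 1)) * (1 + normc (P - 1)) <= expR (normc (F i - 1)) * e.
  by apply: ler_pM; rewrite ?addr_ge0 //; move: IH; lra.
by move: h2 h5; nra.
Qed.

Lemma normc_prod_near1 (I : Type) (r : seq I) (F : I -> R[i]) s :
  \sum_(i <- r) normc (F i - 1) <= s -> s <= 1 / 2 ->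
  normc (\prod_(i <- r) F i - 1) <= 2 * s.
Proof.
move=> h s1; have S0 : 0 <= \sum_(i <- r) normc (F i - 1) by apply: sumr_ge0 => i _; apply: normc_ge0.
rewrite (le_trans (normc_prod_sub1 _ _)) //.
have := expR_le_1D2 S0 (le_trans h s1); lra.
Qed.

Lemma normc_exp_near1 z n s : n%:R * normc (z - 1) <= s -> s <= 1 / 2 ->
  normc (z ^+ n - 1) <= 2 * s.
Proof.
move=> h s1; rewrite -[n]card_ord -prodr_const; apply: normc_prod_near1 => //.
by rewrite sumr_const card_ord -mulr_natl.
Qed.

Lemma natr_inv_sub (k : nat) : (0 < k)%N ->
  (k.+1%:R ^+ 2)^-1 <= k%:R^-1 - k.+1%:R^-1 :> R.
Proof.
move=> k0; have hk : 0 < k%:R :> R by rewrite ltr0n.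
have hk1 : 0 < k%:R + 1 :> R by rewrite addr_gt0.
rewrite -natr1 (_ : k%:R^-1 - _ = (k%:R * (k%:R + 1))^-1); last first.
  by field; rewrite !gt_eqF.
by rewrite lef_pV2 ?posrE ?exprn_gt0 ?mulr_gt0 // expr2 ler_pM2r // lerDl.
Qed.

Lemma sum_inv_sqr (n m : nat) : (0 < n)%N -> (n <= m)%N ->
  \sum_(n.+1 <= k < m.+1) (k%:R ^+ 2)^-1 <= n%:R^-1 - m%:R^-1 :> R.
Proof.
move=> n0 nm; rewrite -(subnKC nm); elim: (m - n)%N => [|k IH].
  by rewrite addn0 big_geq // subrr.
rewrite addnS big_nat_recr /=; last by rewrite ltnS leq_addr.
have := natr_inv_sub (ltn_addr k n0); move: IH; rewrite -addnS addnS.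
move: (\sum_(_ <= _ < _) _) (_ ^-1) (n%:R^-1) ((n + k)%:R^-1) ((n + k).+1%:R^-1) => S x y z t.
by lra.
Qed.

(** Past some rank all the partial products agree up to a factor within 1/2 of 1.
    This bounds them above, so that the increments are summable, and below, so
    that the limit is not 0. *)
Lemma cvgC_infinite_prod (f : nat -> R[i]) (K : R) (N : nat) : 0 <= K -> (0 < N)%N ->
  (forall k, (0 < k)%N -> f k != 0) ->
  (forall k, (N <= k)%N -> normc (f k - 1) <= K * (k%:R ^+ 2)^-1) ->
  exists2 l, l != 0 & cvgC (fun n => \prod_(1 <= k < n.+1) f k) l.
Proof.
move=> K0 N0 f0 hf; pose P n := \prod_(1 <= k < n.+1) f k.
have P0 n : P n != 0.
  rewrite /P big_nat_cond; elim/big_ind: _ => [|x y hx hy|k /andP[/andP[k0 _] _]].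
  - exact: oner_neq0.
  - exact: mulf_neq0.
  - exact: f0.
(* K / n <= 1/4 for n >= M makes the tail sums of K / k^2 at most 1/4. *)
pose M := maxn N (Num.bound (4 * K)).
have NM : (N <= M)%N by exact: leq_maxl.
have M0 : (0 < M)%N by exact: leq_trans N0 NM.
have KM n : (M <= n)%N -> K / n%:R <= 1 / 4.
  move=> Mn; have n0 : 0 < n%:R :> R by rewrite ltr0n (leq_trans M0).
  rewrite ler_pdivrMr //; have : 4 * K < (Num.bound (4 * K))%:R by rewrite archi_boundP // mulr_ge0.
  have : (Num.bound (4 * K))%:R <= n%:R :> R by rewrite ler_nat (leq_trans _ Mn) // leq_maxr.
  by lra.
have tail n m : (M <= n)%N -> (n <= m)%N -> exists2 T, P m = P n * T & normc (T - 1) <= 1 / 2.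
  move=> Mn nm; exists (\prod_(n.+1 <= k < m.+1) f k).
    by rewrite /P -big_cat_nat.
  rewrite (le_trans (@normc_prod_near1 _ _ _ (K / n%:R) _ _)) //; last 2 first.
  - by have := KM n Mn; lra.
  - by have := KM n Mn; lra.
  have n0 : (0 < n)%N := leq_trans M0 Mn.
  apply: (@le_trans _ _ (\sum_(n.+1 <= k < m.+1) K * (k%:R ^+ 2)^-1)).
    apply: ler_sum_nat => k /andP[nk _]; apply: hf.
    by rewrite (leq_trans NM) // (leq_trans Mn) // ltnW.
  rewrite -mulr_sumr ler_wpM2l // (le_trans (sum_inv_sqr n0 nm)) //.
  by rewrite gerBl invr_ge0.
have Pub m : (M <= m)%N -> normc (P m) <= 2 * normc (P M).
  move=> Mm; have [T -> hT] := tail M m (leqnn _) Mm.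
  rewrite normcM mulrC ler_wpM2r ?normc_ge0 //.
  rewrite -[T](subrK 1) (le_trans (normcD _ _)) // normc1; lra.
have Plb m : (M <= m)%N -> normc (P M) / 2 <= normc (P m).
  move=> Mm; have [T -> hT] := tail M m (leqnn _) Mm.
  rewrite normcM ler_wpM2l ?normc_ge0 //.
  have : normc (1 : R[i]) <= normc T + normc (T - 1).
    by rewrite -{1}[1](subKr T) (le_trans (normcB _ _)).
  by rewrite normc1; move: hT; lra.
have [||l hl] := @cvgC_telescope R P (2 * normc (P M) * K) M M0.
- by rewrite !mulr_ge0 ?normc_ge0.
- move=> n Mn; have n0 : (0 < n)%N := leq_trans M0 Mn.
  rewrite /P big_nat_recr //= -/(P n) (_ : _ - _ = P n * (f n.+1 - 1)); last by ring.
  rewrite normcM -[leRHS]mulrA; apply: ler_pM; rewrite ?normc_ge0 ?Pub //.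
  rewrite (le_trans (hf _ _)) ?(leq_trans NM) ?(leqW Mn) //.
  by rewrite ler_wpM2l // natr_inv_sub.
exists l => //; apply/eqP => l0; rewrite l0 in hl.
have PM : 0 < normc (P M) by rewrite normc_gt0.
have [|m hm] := (cvgC_eps P 0).1 hl (normc (P M) / 4); first by rewrite divr_gt0.
have := hm (maxn M m) (leq_maxr _ _); have := Plb (maxn M m) (leq_maxl _ _).
by rewrite subr0; move: PM; lra.
Qed.

Definition barnes_factor z (k : nat) := (1 + z / k%:R) ^+ k * expC (- z + z ^+ 2 / (2 * k%:R)).

Lemma natC_neq0 (k : nat) : (0 < k)%N -> k%:R != 0 :> R[i].
Proof. by rewrite pnatr_eq0 lt0n. Qed.

Lemma barnes_factorE z (k : nat) : (0 < k)%N -> barnes_factor z k = expfac (z / k%:R) ^+ k.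
Proof.
move=> k0; rewrite /barnes_factor /expfac exprMn -expC_natM; congr (_ * expC _).
by field; rewrite natC_neq0.
Qed.

Lemma normc_expfac_div z (k : nat) : (0 < k)%N -> normc z <= k%:R ->
  normc (expfac (z / k%:R) - 1) <= expfacK * normc z ^+ 3 / k%:R ^+ 3.
Proof.
move=> k0 zk; have kp : 0 < k%:R :> R by rewrite ltr0n.
have nE : normc (z / k%:R) = normc z / k%:R by rewrite normcM normcV normc_nat.
apply: le_trans (normc_expfac_sub1 _) _; first by rewrite nE ler_pdivrMr ?mul1r.
by rewrite nE exprMn exprVn mulrA.
Qed.

(** The k-th Barnes factor is the k-th power of an elementary factor at z / k, so
    it differs from 1 by O(1 / k^2). *)
Lemma cvgC_barnes z : (forall k : nat, (0 < k)%N -> 1 + z / k%:R != 0) ->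
  exists2 l, l != 0 & cvgC (fun n => \prod_(1 <= k < n.+1) barnes_factor z k) l.
Proof.
move=> hz; pose K := expfacK * normc z ^+ 3.
have K0 : 0 <= K by rewrite mulr_ge0 ?expfacK_ge0 ?exprn_ge0 ?normc_ge0.
pose N := maxn 1 (maxn (Num.bound (normc z)) (Num.bound (2 * K))).
have K2 : 0 <= 2 * K by rewrite mulr_ge0.
apply: (@cvgC_infinite_prod _ (2 * K) N K2 (leq_maxl _ _)).
- by move=> k k0; rewrite mulf_neq0 ?expf_neq0 ?hz ?expC_neq0.
- move=> k; rewrite !geq_max => /and3P[k0 k1 k2]; rewrite barnes_factorE //.
  have kp : 0 < k%:R :> R by rewrite ltr0n.
  have kz : normc z <= k%:R.
    by rewrite ltW // (lt_le_trans (archi_boundP (normc_ge0 z))) // ler_nat.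
  have kK : 2 * K <= k%:R.
    by rewrite ltW // (lt_le_trans (archi_boundP K2)) // ler_nat.
  rewrite -mulrA; apply: normc_exp_near1.
    rewrite -ler_pdivlMl // (le_trans (normc_expfac_div k0 kz)) // -/K.
    by rewrite le_eqVlt; apply/orP; left; apply/eqP; field; rewrite gt_eqF.
  rewrite ler_pdivrMr ?exprn_gt0 //.
  have : 1 <= k%:R :> R by rewrite ler1n.
  by move: kK; nra.
Qed.

(** The n-th power of the elementary factor at w_n is 1 + O(1 / n^2). *)
Lemma cvgC_pow_exp (w : nat -> R[i]) l : cvgC (fun n => n%:R * w n) l ->
  cvgC (fun n => (1 + w n) ^+ n) (expC l).
Proof.
move=> hw.
have h2 : cvgC (fun n => n%:R * w n ^+ 2) 0.
  apply: (@cvgC_eq _ (fun n => (n%:R * w n) ^+ 2 * (n%:R)^-1) _ _ 1).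
    by move=> n n0; field; rewrite natC_neq0.
  by rewrite -(mulr0 (l ^+ 2)); apply: cvgCM; [exact: cvgCX | exact: cvgC_invn].
have hE : cvgC (fun n => expC (n%:R * w n - n%:R * w n ^+ 2 / 2)) (expC l).
  apply: cvgC_expC; rewrite -[l in X in cvgC _ X]subr0; apply: cvgCB => //.
  by rewrite -(mul0r 2^-1); apply: cvgCM => //; exact: cvgC_cst.
have [N hN] := (cvgC_eps _ _).1 hw 1 ltr01.
pose B := normc l + 1; pose K := expfacK * B ^+ 3.
have B0 : 0 <= B by rewrite addr_ge0 ?normc_ge0.
have K0 : 0 <= K by rewrite mulr_ge0 ?expfacK_ge0 ?exprn_ge0.
pose M := maxn (maxn 1 N) (maxn (Num.bound B) (Num.bound (2 * K))).
have h1 : cvgC (fun n => expfac (w n) ^+ n) 1.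
  apply: (@cvgC_squeeze _ _ _ (fun n => 2 * K * n%:R^-1) M); last first.
    rewrite -(mulr0 (2 * K)); apply: cvgM; first exact: cvg_cst.
    rewrite -cvg_shiftS /=; exact: cvg_harmonic.
  move=> n; rewrite !geq_max => /andP[/andP[n0 nN] /andP[nB nK]].
  have np : 0 < n%:R :> R by rewrite ltr0n.
  have n1 : 1 <= n%:R :> R by rewrite ler1n.
  have Bn : B <= n%:R by rewrite ltW // (lt_le_trans (archi_boundP B0)) // ler_nat.
  have Kn : 2 * K <= n%:R.
    by rewrite ltW // (lt_le_trans (archi_boundP _)) ?mulr_ge0 // ler_nat.
  have wn : normc (w n) <= B / n%:R.
    rewrite ler_pdivlMr // mulrC -normc_nat -normcM -[_ * _](subrK l).
    by rewrite (le_trans (normcD _ _)) // addrC lerD // hN.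
  have w1 : normc (w n) <= 1 by rewrite (le_trans wn) // ler_pdivrMr // mul1r.
  rewrite -mulrA; apply: normc_exp_near1.
    have -> : K / n%:R = n%:R * (K / n%:R ^+ 2) by field; rewrite gt_eqF.
    rewrite ler_wpM2l // (le_trans (normc_expfac_sub1 w1)) //.
    apply: (@le_trans _ _ (K / n%:R ^+ 3)).
      rewrite /K -mulrA ler_wpM2l ?expfacK_ge0 // -exprVn -exprMn.
      by rewrite lerXn2r ?nnegrE ?normc_ge0 ?mulr_ge0 ?invr_ge0.
    by rewrite ler_wpM2l // lef_pV2 ?posrE ?exprn_gt0 // ler_weXn2l.
  by rewrite ler_pdivrMr //; move: Kn; lra.
apply: (@cvgC_eq _ (fun n => expfac (w n) ^+ n * expC (n%:R * w n - n%:R * w n ^+ 2 / 2)) _ _ 0).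
  move=> n _; rewrite [in RHS]expfacE [in RHS]exprMn -[in RHS]expC_natM.
  by congr (_ * expC _); ring.
by rewrite -[expC l]mul1r; apply: cvgCM.
Qed.

End Products.

(** * Harmonic sums over dyadic blocks *)
Section Sums.
Variable R : realType.
Implicit Types (z w l : R[i]) (a b c s t : R).

Definition harm (n : nat) : R[i] := \sum_(1 <= k < n.+1) k%:R^-1.
Definition harm2 (n : nat) : R[i] := \sum_(1 <= k < n.+1) (k%:R ^+ 2)^-1.

Lemma harm0 : harm 0 = 0.
Proof. by rewrite /harm big_geq. Qed.
Lemma harmS n : harm n.+1 = harm n + n.+1%:R^-1.
Proof. by rewrite /harm big_nat_recr. Qed.
Lemma harm2S n : harm2 n.+1 = harm2 n + (n.+1%:R ^+ 2)^-1.
Proof. by rewrite /harm2 big_nat_recr. Qed.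

Lemma harm_real n : harm n = (\sum_(1 <= k < n.+1) k%:R^-1)%:C.
Proof.
rewrite /harm rmorph_sum /=; apply: eq_bigr => k _.
by rewrite fmorphV /= natrC.
Qed.

Lemma natS_neq0 n : n%:R + 1 != 0 :> R[i].
Proof. by rewrite natr1 pnatr_eq0. Qed.

Lemma euler_gamma_cvg :
  cvgC (fun n => harm n - (ln n%:R)%:C) (euler_gamma R)%:C.
Proof.
pose v n : R := \sum_(1 <= k < n.+1) k%:R^-1 - ln (n%:R : R).
have vE n : harm n - (ln n%:R)%:C = (v n)%:C by rewrite harm_real -rmorphB.
have [|l hl] := @cvgC_telescope R (fun n => (v n)%:C) 1 1 isT ler01.
  move=> n n0; have np : 0 < n%:R :> R by rewrite ltr0n.
  have np1 : 0 < n.+1%:R :> R by rewrite ltr0n.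
  rewrite -rmorphB normcR mul1r /v big_nat_recr //=.
  have h1 : ln (n.+1%:R / n%:R : R) <= n%:R^-1.
    rewrite -natr1 mulrDl divff ?gt_eqF // mul1r; apply: le_ln1Dx.
    by rewrite (lt_trans _ (_ : 0 < _)) ?invr_gt0 // ltrN10.
  have h2 : ln (n%:R / n.+1%:R : R) <= - n.+1%:R^-1.
    have -> : n%:R / n.+1%:R = 1 + (- n.+1%:R^-1) :> R.
      by rewrite -natr1; field; rewrite gt_eqF // natr1.
    apply: le_ln1Dx; rewrite ltrN2 invf_lt1 // ltr1n ltnS //.
  move: h1 h2; rewrite !ln_div ?posrE // ler_norml.
  move: (\sum_(_ <= _ < _) _) => S; set x := ln _; set y := ln _.
  move: (n%:R^-1) (n.+1%:R^-1) => p q h1 h2; apply/andP; split; lra.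
have vl : v @ \oo --> complex.Re l by case: hl.
have -> : euler_gamma R = complex.Re l by apply: cvg_lim vl.
under eq_fun do rewrite vE.
exact: cvgC_real.
Qed.

Lemma natr_dbl (n : nat) : n.*2%:R = 2 * n%:R :> R[i].
Proof. by rewrite -addnn natrD; ring. Qed.

Lemma cvgC_harm_dbl : cvgC (fun n => harm n.*2 - harm n) (ln 2)%:C.
Proof.
have h2 : cvgC (fun n => harm n.*2 - (ln (n.*2)%:R)%:C) (euler_gamma R)%:C.
  apply: (cvgC_sub (f := fun n => n.*2) _ euler_gamma_cvg).
  by move=> n; rewrite -addnn leq_addr.
have := cvgCD (cvgCB h2 euler_gamma_cvg) (cvgC_cst (ln (2 : R))%:C).
rewrite subrr add0r; apply: (@cvgC_eq _ _ _ _ 1) => n n0.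
have -> : ln (n.*2)%:R = ln 2 + ln n%:R :> R.
  rewrite -lnM ?posrE ?ltr0n // -natrM; congr (ln _%:R).
  by rewrite mul2n.
by rewrite rmorphD /=; ring.
Qed.

Lemma cvgC_inv_affine (p q : R[i]) : p != 0 ->
  cvgC (fun n => (p + q * n%:R^-1)^-1) p^-1.
Proof.
move=> p0; apply: cvgCV => //; rewrite -[p in X in cvgC _ X]addr0 -(mulr0 q).
apply: cvgCD; first exact: cvgC_cst.
apply: cvgCM; [exact: cvgC_cst | exact: cvgC_invn].
Qed.

Lemma dblS_neq0 n : 2 * n%:R + 1 != 0 :> R[i].
Proof. by rewrite -natr_dbl natr1 pnatr_eq0. Qed.

Lemma dblSS_neq0 n : 2 * n%:R + 1 + 1 != 0 :> R[i].
Proof. by rewrite -natr_dbl !natr1 pnatr_eq0. Qed.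

Lemma two_neq0 : 2 != 0 :> R[i]. Proof. by rewrite pnatr_eq0. Qed.

Lemma two_inv_neq0 n : (0 < n)%N -> 2 + 1 * n%:R^-1 != 0 :> R[i].
Proof.
move=> n0; have h := natC_neq0 R n0.
rewrite (_ : _ + _ = (2 * n%:R + 1) / n%:R); last by field.
by rewrite mulf_neq0 ?invr_eq0 // dblS_neq0.
Qed.

Lemma one_inv_neq0 n : (0 < n)%N -> 1 + 1 * n%:R^-1 != 0 :> R[i].
Proof.
move=> n0; have h := natC_neq0 R n0.
rewrite (_ : _ + _ = (n%:R + 1) / n%:R); last by field.
by rewrite mulf_neq0 ?invr_eq0 // natS_neq0.
Qed.

(** By [cvgC_stolz], as the increment of the difference is
    1 / ((2n + 1) (2n + 2)). *)
Lemma cvgC_harm_dbl_rate :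
  cvgC (fun n => n%:R * (harm n.*2 - harm n - (ln 2)%:C)) (- (1 / 4)).
Proof.
apply: cvgC_stolz.
  by rewrite -(subrr (ln 2)%:C); apply: cvgCB; [exact: cvgC_harm_dbl | exact: cvgC_cst].
have -> : - (1 / 4) = - (1 / 2) * 2^-1 :> R[i] by field.
apply: (@cvgC_eq _ (fun n => - (1 / 2) * (2 + 1 * n%:R^-1)^-1) _ _ 1); last first.
  apply: cvgCM; first exact: cvgC_cst.
  exact: (cvgC_inv_affine 1 two_neq0).
move=> n n0; have h := natC_neq0 R n0.
have h1 := natS_neq0 n; have h2 := dblS_neq0 n; have h3 := two_inv_neq0 n0.
rewrite doubleS !harmS -!natr1 natr_dbl.
by field; rewrite h h1 h2 dblSS_neq0.
Qed.

Lemma normc_sum (I : Type) (r : seq I) (P : pred I) (F : I -> R[i]) :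
  normc (\sum_(i <- r | P i) F i) <= \sum_(i <- r | P i) normc (F i).
Proof.
elim/big_ind2: _ => [|x a y b ha hb|//]; first by rewrite normc0.
by rewrite (le_trans (normcD _ _)) // lerD.
Qed.

Lemma cvgC_harm2_dbl : cvgC (fun n => harm2 n.*2 - harm2 n) 0.
Proof.
apply: (@cvgC_squeeze _ _ _ (fun n => n%:R^-1) 1); last first.
  rewrite -cvg_shiftS /=; exact: cvg_harmonic.
move=> n n0; rewrite subr0.
have nn : (n <= n.*2)%N by rewrite -addnn leq_addr.
have -> : harm2 n.*2 - harm2 n = \sum_(n.+1 <= k < n.*2.+1) (k%:R ^+ 2)^-1.
  by rewrite /harm2 (@big_cat_nat _ _ _ n.+1 1 n.*2.+1) //= addrAC subrr add0r.
rewrite (le_trans (normc_sum _ _ _)) //.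
under eq_bigr do rewrite normcV normcX normc_nat.
by rewrite (le_trans (sum_inv_sqr _ n0 nn)) // gerBl invr_ge0.
Qed.

Lemma cvgC_harm2_dbl_rate :
  cvgC (fun n => n%:R * (harm2 n.*2 - harm2 n)) (1 / 2).
Proof.
apply: cvgC_stolz; first exact: cvgC_harm2_dbl.
have -> : 1 / 2 = 3 / 4 * 1^-1 - (1 + 1 * 0) * 2^-1 * 2^-1 :> R[i] by field.
apply: (@cvgC_eq _ (fun n => 3 / 4 * (1 + 1 * n%:R^-1)^-1 -
   (1 + 1 * n%:R^-1) * (2 + 1 * n%:R^-1)^-1 * (2 + 1 * n%:R^-1)^-1) _ _ 1); last first.
  have c2 := cvgC_inv_affine 1 two_neq0.
  apply: cvgCB.
    by apply: cvgCM; [exact: cvgC_cst | apply: cvgC_inv_affine; exact: oner_neq0].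
  apply: cvgCM => //; apply: cvgCM => //; apply: cvgCD; first exact: cvgC_cst.
  by apply: cvgCM; [exact: cvgC_cst | exact: cvgC_invn].
move=> n n0; have h := natC_neq0 R n0.
have h1 := natS_neq0 n; have h2 := dblS_neq0 n.
have h3 := two_inv_neq0 n0; have h5 := one_inv_neq0 n0.
rewrite doubleS !harm2S -!natr1 natr_dbl.
by field; rewrite h h1 h2 dblSS_neq0.
Qed.
End Sums.

(** * Comparison with the truncated Barnes products *)
Section Asymp.
Variable R : realType.
Variable alpha : R[i].
Hypothesis alpha_re : - (1 / 2) < complex.Re alpha.
Implicit Types (z w l : R[i]) (a b c s t : R).
Notation harm := (@harm R).
Notation harm2 := (@harm2 R).
Notation B := (ratioB alpha).
Notation H := (ratioH alpha).

Lemma neq0_of_re z : 0 < complex.Re z -> z != 0.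
Proof. by apply: contraTneq => ->; rewrite ltxx. Qed.

Lemma half_invE : (2^-1 : R[i]) = (2^-1 : R)%:C.
Proof. by rewrite fmorphV /= natrC. Qed.

Lemma alphaS_neq0 n : alpha + n%:R + 1 != 0.
Proof.
apply: neq0_of_re; rewrite !cReD cRe_nat /=.
by have := ler0n R n; move: alpha_re; lra.
Qed.

Lemma alphaH_neq0 n : alpha + n%:R + 2^-1 != 0.
Proof.
apply: neq0_of_re; rewrite !cReD cRe_nat half_invE /=.
by have := ler0n R n; move: alpha_re; lra.
Qed.

Lemma halfS_neq0 n : n%:R + 2^-1 != 0 :> R[i].
Proof. by rewrite addrC half_neq0. Qed.

Lemma ratioB_S n : B n.+1 = B n * ((alpha + n%:R + 1) / (n%:R + 1)).
Proof.
rewrite /ratioB big_ord_recr /=; congr (_ * _); rewrite -natr1.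
by field; rewrite natS_neq0.
Qed.

Lemma ratioH_S n : H n.+1 = H n * ((alpha + n%:R + 2^-1) / (n%:R + 2^-1)).
Proof.
rewrite /ratioH big_ord_recr /=; congr (_ * _).
rewrite -[X in X + _](divff (halfS_neq0 n)) -mulrDl; congr (_ / _); ring.
Qed.

Lemma ratioB_neq0 n : B n != 0.
Proof.
elim: n => [|n IH]; first by rewrite /ratioB big_ord0 oner_neq0.
by rewrite ratioB_S !mulf_neq0 ?invr_eq0 ?alphaS_neq0 ?natS_neq0.
Qed.

Lemma ratioH_neq0 n : H n != 0.
Proof.
elim: n => [|n IH]; first by rewrite /ratioH big_ord0 oner_neq0.
by rewrite ratioH_S !mulf_neq0 ?invr_eq0 ?alphaH_neq0 ?halfS_neq0.
Qed.

(** Consecutive terms of t_n = c B_n / H_n have ratio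
    1 - alpha / (2 (n + 1) (alpha + n + 1/2)), so [cvgC_stolz] gives
    n (phi / t_n - 1) --> - alpha / 2. *)
Lemma ratio_coef0_power (c phi : R[i]) : c != 0 -> phi != 0 ->
  cvgC (fun n => c * B n / H n) phi ->
  cvgC (fun n => (phi / (c * B n / H n)) ^+ n) (expC (- alpha / 2)).
Proof.
move=> c0 p0 ht; pose y n := phi / (c * B n / H n).
have cy : cvgC y 1 by rewrite -(divff p0); apply: cvgCM; [exact: cvgC_cst | exact: cvgCV].
have yE n : y n = 1 + (y n - 1) by ring.
rewrite (_ : (fun n => _) = (fun n => (1 + (y n - 1)) ^+ n)); last by apply/funext => n; rewrite -yE.
apply: cvgC_pow_exp; apply: cvgC_stolz.
  by rewrite -(subrr 1); apply: cvgCB => //; exact: cvgC_cst.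
have nz n : (0 < n)%N -> 2 + (2 * alpha + 1) * n%:R^-1 != 0.
  move=> n0; have -> : 2 + (2 * alpha + 1) * n%:R^-1 = 2 * (alpha + n%:R + 2^-1) / n%:R.
    by field; exact: natC_neq0.
  by rewrite !mulf_neq0 ?invr_eq0 ?natC_neq0 ?alphaH_neq0 ?two_neq0.
apply: (@cvgC_eq _ (fun n => - alpha * y n.+1 * (2 + (2 * alpha + 1) * n%:R^-1)^-1) _ _ 1); last first.
  rewrite -[X in cvgC _ (X * _)]mulr1; apply: cvgCM; last by apply: cvgC_inv_affine; exact: two_neq0.
  apply: cvgCM; first exact: cvgC_cst.
  exact: (cvgC_sub (f := fun n => n.+1) _ cy).
move=> n n0.
have yS : y n.+1 = y n * ((alpha + n%:R + 2^-1) / (n%:R + 2^-1) / ((alpha + n%:R + 1) / (n%:R + 1))).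
  rewrite /y ratioB_S ratioH_S; move: (alphaS_neq0 n) (alphaH_neq0 n) (halfS_neq0 n) (natS_neq0 R n) (ratioB_neq0 n) (ratioH_neq0 n).
  set p := alpha + _ + 1; set q := alpha + _ + 2^-1; set r := _ + 2^-1; set s := _ + 1.
  by move=> *; field; do ?[assumption | apply/andP; split].
have yS' : y n = y n.+1 * ((alpha + n%:R + 1) / (n%:R + 1) / ((alpha + n%:R + 2^-1) / (n%:R + 2^-1))).
  rewrite yS; move: (alphaS_neq0 n) (alphaH_neq0 n) (halfS_neq0 n) (natS_neq0 R n).
  set p := alpha + _ + 1; set q := alpha + _ + 2^-1; set r := _ + 2^-1; set s := _ + 1.
  by move=> *; field; do ?[assumption | apply/andP; split].
have -> : y n - 1 - (y n.+1 - 1) = y n - y n.+1 by ring.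
rewrite {1}yS' -[n.+1%:R]natr1.
have -> : (2 + (2 * alpha + 1) / n%:R)^-1 = n%:R / (2 * (alpha + n%:R + 2^-1)).
  have -> : 2 + (2 * alpha + 1) / n%:R = 2 * (alpha + n%:R + 2^-1) / n%:R.
    by field; exact: natC_neq0.
  by rewrite invfM invrK mulrC.
have e1 : 2 * (alpha + n%:R + 2^-1) = 2 * alpha + 2 * n%:R + 1 by field.
have h1 := alphaH_neq0 n; have h2 := halfS_neq0 n; have h3 := natS_neq0 R n.
field; rewrite [n%:R * 2]mulrC dblS_neq0 h3 andbT /=.
have -> : (alpha + n%:R) * 2 + 1 = 2 * (alpha + n%:R + 2^-1) by field.
by rewrite mulf_neq0 ?two_neq0.
Qed.

Definition expfac_block n m := \prod_(n.+1 <= i < m.+1) expfac (alpha / i%:R).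

Lemma ratioB_block n k : B (n + k) / B n = expfac_block n (n + k) *
  expC (alpha * (harm (n + k) - harm n) - alpha ^+ 2 / 2 * (harm2 (n + k) - harm2 n)).
Proof.
elim: k => [|k IH].
  by rewrite addn0 divff ?ratioB_neq0 // /expfac_block big_geq // !subrr !mulr0 subrr expC0 mulr1.
rewrite addnS /ratioB big_ord_recr /= -/(B _) mulrAC IH /expfac_block.
rewrite [in RHS]big_nat_recr ?ltnS ?leq_addr //=.
rewrite [in LHS](expfacE (alpha / _)) harmS harm2S.
set E := expC _; set E' := expC _; set E'' := expC _.
have -> : E'' = E * E'.
  rewrite /E /E' /E'' -expCD; congr expC.
  by field; rewrite -natrD nat1r pnatr_eq0.
by ring.
Qed.

(** Summation by parts. *)
Lemma sum_harm n j : \sum_(k < j) harm (n + k) =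
  (n + j)%:R * harm (n + j) - (n + j)%:R - (n%:R * harm n - n%:R).
Proof.
elim: j => [|j IH]; first by rewrite big_ord0 addn0 subrr.
rewrite big_ord_recr /= IH addnS harmS.
by field; rewrite -natrD nat1r pnatr_eq0.
Qed.

Lemma sum_harm2 n j : \sum_(k < j) harm2 (n + k) =
  (n + j)%:R * harm2 (n + j) - harm (n + j) - (n%:R * harm2 n - harm n).
Proof.
elim: j => [|j IH]; first by rewrite big_ord0 addn0 subrr.
rewrite big_ord_recr /= IH addnS harmS harm2S.
by field; rewrite -natrD nat1r pnatr_eq0.
Qed.

(** The sum over n <= m < 2n and n < i <= m of alpha / i - alpha^2 / (2 i^2). *)
Definition block_exponent n := 
  alpha * (2 * n%:R * (harm n.*2 - harm n) - n%:R)
  - alpha ^+ 2 / 2 * (2 * n%:R * (harm2 n.*2 - harm2 n) - (harm n.*2 - harm n)).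

Lemma ratioB_block_prod n : \prod_(k < n) (B (n + k) / B n) =
  \prod_(k < n) expfac_block n (n + k) * expC (block_exponent n).
Proof.
under eq_bigr do rewrite ratioB_block; rewrite big_split /= -expC_sum; congr (_ * expC _).
have cst_sum (x : R[i]) : \sum_(k < n) x = n%:R * x by rewrite sumr_const card_ord mulr_natl.
rewrite sumrB -!mulr_sumr !sumrB sum_harm sum_harm2 !cst_sum addnn natr_dbl /block_exponent.
by field.
Qed.

(** The block product has n factors, each of them a product of at most n
    elementary factors within O(1 / n^3) of 1. *)
Lemma cvgC_block_prod : cvgC (fun n => \prod_(k < n) expfac_block n (n + k)) 1.
Proof.
pose K := expfacK R * normc alpha ^+ 3.
have K0 : 0 <= K by rewrite mulr_ge0 ?expfacK_ge0 ?exprn_ge0 ?normc_ge0.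
have K4 : 0 <= 4 * K by rewrite mulr_ge0.
pose M := maxn 1 (maxn (Num.bound (normc alpha)) (Num.bound (4 * K))).
apply: (@cvgC_squeeze _ _ _ (fun n => 4 * K * n%:R^-1) M); last first.
  rewrite -(mulr0 (4 * K)); apply: cvgM; first exact: cvg_cst.
  rewrite -cvg_shiftS /=; exact: cvg_harmonic.
move=> n; rewrite !geq_max => /and3P[n0 na nK].
have np : 0 < n%:R :> R by rewrite ltr0n.
have n1 : 1 <= n%:R :> R by rewrite ler1n.
have an : normc alpha <= n%:R.
  by rewrite ltW // (lt_le_trans (archi_boundP (normc_ge0 alpha))) // ler_nat.
have Kn : 4 * K <= n%:R.
  by rewrite ltW // (lt_le_trans (archi_boundP K4)) // ler_nat.
have KKn : K / n%:R ^+ 2 <= 1 / 2.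
  rewrite ler_pdivrMr ?exprn_gt0 //; move: Kn n1; nra.
have hT k : (k <= n)%N -> normc (expfac_block n (n + k) - 1) <= 2 * (K / n%:R ^+ 2).
  move=> kn; apply: normc_prod_near1 => //.
  apply: (@le_trans _ _ (\sum_(n.+1 <= i < (n + k).+1) K / n%:R ^+ 3)).
    apply: ler_sum_nat => i /andP[ni _].
    have ni' : n%:R <= i%:R :> R by rewrite ler_nat ltnW.
    rewrite (le_trans (normc_expfac_div (leq_trans n0 (ltnW ni)) (le_trans an ni'))) //.
    rewrite ler_wpM2l // lef_pV2 ?posrE ?exprn_gt0 ?(lt_le_trans np) //.
    by rewrite lerXn2r ?nnegrE ?ler0n.
  rewrite sumr_const_nat subSS addKn -[(K / _) *+ k]mulr_natl.
  have -> : K / n%:R ^+ 2 = n%:R * (K / n%:R ^+ 3) by field; rewrite gt_eqF.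
  by apply: ler_wpM2r; rewrite ?ler_nat // divr_ge0 // exprn_ge0 // ler0n.
have -> : 4 * K / n%:R = 2 * (2 * K / n%:R) by field; rewrite gt_eqF.
apply: normc_prod_near1; last by rewrite ler_pdivrMr //; move: Kn; lra.
apply: (@le_trans _ _ (\sum_(k < n) 2 * (K / n%:R ^+ 2))).
  by apply: ler_sum => k _; apply: hT; apply: ltnW.
rewrite sumr_const card_ord -[(2 * _) *+ n]mulr_natl le_eqVlt; apply/orP; left; apply/eqP.
by field; rewrite gt_eqF.
Qed.

Lemma prod_dbl (g : nat -> R[i]) n :
  \prod_(m < n.*2) g m = \prod_(k < n) (g k.*2 * g k.*2.+1).
Proof.
elim: n => [|n IH]; first by rewrite !big_ord0.
by rewrite doubleS !big_ord_recr /= IH mulrA.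
Qed.

(** The denominators B_(2k) B_(2k+1) run over all B_m with m < 2n; those with
    m < n cancel the numerators. *)
Lemma det_product_split (phi : R[i]) n :
  \prod_(k < n) (phi * (H k * B k / (B k.*2 * B k.*2.+1))) =
  phi ^+ n * (\prod_(k < n) H k / B n ^+ n) / \prod_(k < n) (B (n + k) / B n).
Proof.
have BE : \prod_(k < n) (B k.*2 * B k.*2.+1) = \prod_(k < n) B k * \prod_(k < n) B (n + k).
  by rewrite -prod_dbl -addnn big_split_ord.
rewrite !big_split /= !prodr_const !card_ord !prodfV BE exprVn.
have h (g : nat -> R[i]) : (forall k, g k != 0) -> \prod_(k < n) g k != 0.
  by move=> h; apply/prodf_neq0.
have h1 := h _ ratioB_neq0; have h2 := h _ (fun k => ratioB_neq0 (n + k)).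
by field; rewrite ?h1 ?h2 ?expf_neq0 ?ratioB_neq0.
Qed.

Definition barnes_prod n z : R[i] := \prod_(1 <= k < n.+1) barnes_factor z k.

Lemma barnes_prodS n z : barnes_prod n.+1 z = barnes_prod n z * barnes_factor z n.+1.
Proof. by rewrite /barnes_prod big_nat_recr. Qed.

(** This is the duplication formula of the Barnes function at the level of
    factors: the even-numbered factors at 2 alpha are squares of those at alpha. *)
Lemma barnes_factor_dbl k : (0 < k)%N ->
  barnes_factor (2 * alpha) k.*2 = barnes_factor alpha k ^+ 2.
Proof.
move=> k0; have h := natC_neq0 R k0.
rewrite /barnes_factor natr_dbl [RHS]exprMn -[in RHS]exprM muln2 -[in RHS]expC_natM; congr (_ ^+ _ * expC _).
  by field.
by field.
Qed.

Lemma one_add_div_neq0 z k : - 1 < complex.Re z -> (0 < k)%N -> 1 + z / k%:R != 0.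
Proof.
move=> hz k0; have h := natC_neq0 R k0.
rewrite (_ : _ + _ = (z + k%:R) / k%:R); last by field.
rewrite mulf_neq0 ?invr_eq0 //; apply: neq0_of_re; rewrite cReD cRe_nat.
have : 1 <= k%:R :> R by rewrite ler1n. move: hz. move: (complex.Re z) => x; lra.
Qed.

Lemma barnes_factor_neq0 z k : - 1 < complex.Re z -> (0 < k)%N -> barnes_factor z k != 0.
Proof.
by move=> hz k0; rewrite mulf_neq0 ?expC_neq0 ?expf_neq0 ?one_add_div_neq0.
Qed.

Lemma barnes_prod_neq0 n z : - 1 < complex.Re z -> barnes_prod n z != 0.
Proof.
move=> hz; elim: n => [|n IH]; first by rewrite /barnes_prod big_geq // oner_neq0.
by rewrite barnes_prodS mulf_neq0 // barnes_factor_neq0.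
Qed.

Lemma re_half : complex.Re (1 / 2 : R[i]) = 1 / 2.
Proof. by rewrite mul1r half_invE /= mul1r. Qed.

Lemma re_half_alpha : - 1 < complex.Re (1 / 2 + alpha).
Proof. by rewrite cReD re_half; move: alpha_re; lra. Qed.
Lemma re_alpha : - 1 < complex.Re alpha.
Proof. by move: alpha_re; lra. Qed.
Lemma re_half_gt : - 1 < complex.Re (1 / 2 : R[i]).
Proof. by rewrite re_half; lra. Qed.
Lemma re_2alpha : - 1 < complex.Re (2 * alpha).
Proof. by rewrite -natrC cReMr; move: alpha_re; lra. Qed.

Definition barnes_ratio n := barnes_prod n (1 / 2 + alpha) * barnes_prod n alpha ^+ 2 /
  (barnes_prod n (1 / 2) * barnes_prod n.*2 (2 * alpha)).

(** H_(n+1) / H_n. *)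
Definition shift_ratio n := (alpha + n%:R + 2^-1) / (n%:R + 2^-1).

(** By [barnes_factor_dbl] only the odd-numbered factors at 2 alpha survive in
    the quotient of consecutive terms, and 1 + 2 alpha / (2n + 1) is
    [shift_ratio n]. *)
Lemma barnes_ratioE n : barnes_ratio n =
  (\prod_(k < n) H k / H n ^+ n) * shift_ratio n ^+ n *
  expC (n%:R * alpha + harm n * (alpha + 3 * alpha ^+ 2) / 2 - 2 * alpha ^+ 2 * harm n.*2).
Proof.
elim: n => [|n IH].
  rewrite /barnes_ratio /barnes_prod double0 !big_geq // big_ord0 !harm0.
  by rewrite !expr1n !expr0 !mul0r !mulr0 addr0 subrr expC0 !mulr1 divr1.
have -> : barnes_ratio n.+1 = barnes_ratio n *
    (barnes_factor (1 / 2 + alpha) n.+1 / (barnes_factor (1 / 2) n.+1 *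
      barnes_factor (2 * alpha) n.*2.+1)).
  rewrite /barnes_ratio doubleS !barnes_prodS -doubleS barnes_factor_dbl //.
  have h1 := barnes_prod_neq0 n re_half_gt; have h2 := barnes_prod_neq0 n.*2 re_2alpha.
  have h3 := barnes_factor_neq0 re_half_gt (ltn0Sn n).
  have h4 := barnes_factor_neq0 re_2alpha (ltn0Sn n.*2).
  have h5 := barnes_factor_neq0 re_alpha (ltn0Sn n).
  by field; rewrite h1 h2 h3 h4 h5.
have sE k : shift_ratio k != 0 by rewrite mulf_neq0 ?invr_eq0 ?alphaH_neq0 ?halfS_neq0.
have f1 : barnes_factor (1 / 2 + alpha) n.+1 / barnes_factor (1 / 2) n.+1 =
    shift_ratio n.+1 ^+ n.+1 * expC (- alpha + (alpha + alpha ^+ 2) / (2 * n.+1%:R)).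
  have h := natC_neq0 R (ltn0Sn n); have h2 := halfS_neq0 n.+1.
  rewrite /barnes_factor -mulf_div -expr_div_n -expCB; congr (_ ^+ _ * expC _).
    rewrite /shift_ratio (_ : 1 + (1 / 2 + alpha) / n.+1%:R = (alpha + n.+1%:R + 2^-1) / n.+1%:R); last first.
      by field.
    rewrite (_ : 1 + 1 / 2 / n.+1%:R = (n.+1%:R + 2^-1) / n.+1%:R); last by field.
    by rewrite -mulf_div divff ?invr_eq0 // mulr1.
  by field.
have f2 : barnes_factor (2 * alpha) n.*2.+1 =
    shift_ratio n ^+ n.*2.+1 * expC (- (2 * alpha) + 2 * alpha ^+ 2 / n.*2.+1%:R).
  have h := natC_neq0 R (ltn0Sn n.*2); have h2 := halfS_neq0 n; have h3 := dblS_neq0 R n.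
  rewrite /barnes_factor; congr (_ ^+ _ * expC _); last by field.
  rewrite /shift_ratio -[n.*2.+1%:R]natr1 natr_dbl.
  rewrite (_ : 2 * n%:R + 1 = 2 * (n%:R + 2^-1)); last by field.
  rewrite -[alpha + _ + _]addrA; move: h2; set r := n%:R + _ => h2.
  by field.
have f3 (x y z : R[i]) : x / (y * z) = x / y / z by rewrite invfM mulrA.
rewrite f3 f1 f2 IH big_ord_recr /= ratioH_S -/(shift_ratio n) doubleS !harmS.
set E := expC _; set E1 := expC (- alpha + _); set E2 := expC (- (2 * alpha) + _).
have -> : expC (n.+1%:R * alpha + (harm n + n.+1%:R^-1) * (alpha + 3 * alpha ^+ 2) / 2 -
  2 * alpha ^+ 2 * (harm n.*2 + n.*2.+1%:R^-1 + n.*2.+2%:R^-1)) = E * E1 / E2.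
  rewrite /E /E1 /E2 -expCD -expCB; congr expC.
  have h3 := dblS_neq0 R n; have h4 := dblSS_neq0 R n; have h5 := natS_neq0 R n.
  rewrite -[n.*2.+2%:R]natr1 -[n.*2.+1%:R]natr1 natr_dbl -[n.+1%:R]natr1.
  by field; rewrite h3 h4 h5.
have hE : E2 != 0 by exact: expC_neq0.
have hs := expf_neq0 n (sE n); have hh := expf_neq0 n (ratioH_neq0 n).
rewrite [(H n * _) ^+ _]exprMn [shift_ratio n ^+ n.*2.+1]exprS -addnn exprD [H n ^+ n.+1]exprS [shift_ratio n ^+ n.+1]exprS.
have hn := ratioH_neq0 n; have sn := sE n.
move: hs hh hn sn; move: (shift_ratio n) (H n) => s h hs hh hn sn.
by field; rewrite hs hh hn sn hE.
Qed.

(** After [det_product_split] and [barnes_ratioE] the product of the H_k cancels,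
    and the exponentials merge into one whose exponent converges to 3 alpha / 2.
    This balances the limits exp (- alpha / 2) of (phi / t_n)^n and exp (- alpha) of
    [shift_ratio n ^- n]. *)
Lemma asymptotic_ratio (c phi : R[i]) (G1 G2 G3 G4 : R[i]) :
  c = (ln (4 : R))%:C -> phi != 0 ->
  cvgC (fun n => expC (alpha * c) * B n / H n) phi ->
  G1 != 0 -> G2 != 0 -> G3 != 0 -> G4 != 0 ->
  cvgC (fun n => barnes_prod n (1 / 2 + alpha)) G1 ->
  cvgC (fun n => barnes_prod n alpha) G2 ->
  cvgC (fun n => barnes_prod n (1 / 2)) G3 ->
  cvgC (fun n => barnes_prod n (2 * alpha)) G4 ->
  cvgC (fun n => (\prod_(k < n) (phi * (H k * B k / (B k.*2 * B k.*2.+1)))) /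
    (expC ((alpha ^+ 2 - alpha) / 2 * (ln n%:R)%:C + 3 * alpha ^+ 2 / 2 * (ln 2)%:C
        - (2 * alpha - alpha ^+ 2) / 2 - (euler_gamma R)%:C * (alpha - alpha ^+ 2) / 2)
      * (G1 * G2 ^+ 2 / (G3 * G4)))) 1.
Proof.
move=> -> p0 ht g1 g2 g3 g4 c1 c2 c3 c4.
(* D n is the total exponent, arranged so that every bracket has a known limit. *)
pose D n := - (2 * alpha) * (n%:R * (harm n.*2 - harm n - (ln 2)%:C))
   + alpha ^+ 2 * (n%:R * (harm2 n.*2 - harm2 n))
   + 3 / 2 * alpha ^+ 2 * (harm n.*2 - harm n - (ln 2)%:C)
   + (alpha ^+ 2 - alpha) / 2 * (harm n - (ln n%:R)%:C - (euler_gamma R)%:C)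
   + (2 * alpha - alpha ^+ 2) / 2.
have cD : cvgC (fun n => expC (D n)) (expC (3 / 2 * alpha)).
  apply: cvgC_expC.
  have -> : 3 / 2 * alpha = - (2 * alpha) * - (1 / 4) + alpha ^+ 2 * (1 / 2)
     + 3 / 2 * alpha ^+ 2 * ((ln 2)%:C - (ln 2)%:C)
     + (alpha ^+ 2 - alpha) / 2 * ((euler_gamma R)%:C - (euler_gamma R)%:C)
     + (2 * alpha - alpha ^+ 2) / 2 by field.
  apply: cvgCD; last exact: cvgC_cst.
  apply: cvgCD; last first.
    by apply: cvgCM; [exact: cvgC_cst | apply: cvgCB; [exact: euler_gamma_cvg | exact: cvgC_cst]].
  apply: cvgCD; last first.
    by apply: cvgCM; [exact: cvgC_cst | apply: cvgCB; [exact: cvgC_harm_dbl | exact: cvgC_cst]].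
  apply: cvgCD; (apply: cvgCM; first exact: cvgC_cst).
    exact: cvgC_harm_dbl_rate.
  exact: cvgC_harm2_dbl_rate.
have cphi := ratio_coef0_power (expC_neq0 _) p0 ht.
have cs : cvgC (fun n => (shift_ratio n ^+ n)^-1) (expC alpha)^-1.
  apply: cvgCV; first exact: expC_neq0.
  have -> : (fun n => shift_ratio n ^+ n) = (fun n => (1 + alpha / (n%:R + 2^-1)) ^+ n).
    apply/funext => n; congr (_ ^+ _); rewrite /shift_ratio.
    rewrite -[alpha + _ + _]addrA; move: (halfS_neq0 n); set r := n%:R + _ => h.
    by field.
  apply: cvgC_pow_exp.
  have -> : alpha = alpha * 1^-1 by rewrite invr1 mulr1.
  apply: (@cvgC_eq _ (fun n => alpha * (1 + 2^-1 * n%:R^-1)^-1) _ _ 1); last first.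
    by apply: cvgCM; [exact: cvgC_cst | apply: cvgC_inv_affine; exact: oner_neq0].
  move=> n n0; have h := natC_neq0 R n0; have h2 := halfS_neq0 n.
  have -> : 1 + 2^-1 / n%:R = (n%:R + 2^-1) / n%:R :> R[i] by field.
  by rewrite invr1 mulr1 invf_div mulrCA.
have cG : cvgC barnes_ratio (G1 * G2 ^+ 2 / (G3 * G4)).
  apply: cvgCM; first by apply: cvgCM => //; exact: cvgCX.
  apply: cvgCV; first exact: mulf_neq0.
  apply: cvgCM => //; apply: (cvgC_sub (f := fun n => n.*2) _ c4).
  by move=> n; rewrite -addnn leq_addr.
set G := G1 * _ / _ in cG *.
have G0 : G != 0 by rewrite /G !mulf_neq0 ?expf_neq0 ?invr_eq0 ?mulf_neq0.
pose U n := \prod_(k < n) expfac_block n (n + k).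
have cU : cvgC (fun n => (U n)^-1) 1.
  by rewrite -[1]invr1; apply: cvgCV; [exact: oner_neq0 | exact: cvgC_block_prod].
have lim1 : expC (- alpha / 2) * (G * G^-1) * (expC alpha)^-1 * 1 * expC (3 / 2 * alpha) = 1.
  have -> : 3 / 2 * alpha = alpha / 2 + alpha by field.
  by rewrite divff // !mulr1 expCD mulNr expCN; field; rewrite !expC_neq0.
rewrite -[X in cvgC _ X]lim1; apply: (@cvgC_eq _ (fun n =>
   (phi / (expC (alpha * (ln 4)%:C) * B n / H n)) ^+ n * (barnes_ratio n * G^-1) *
   (shift_ratio n ^+ n)^-1 * (U n)^-1 * expC (D n)) _ _ 1); last first.
  exact: cvgCM (cvgCM (cvgCM (cvgCM cphi (cvgCM cG (cvgC_cst _))) cs) cU) cD.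
move=> n n0; cbv beta; rewrite (det_product_split phi n) ratioB_block_prod barnes_ratioE -/(U n).
have pw (p u v w : R[i]) : (p / (u * v / w)) ^+ n = p ^+ n * w ^+ n / (u ^+ n * v ^+ n).
  by rewrite expr_div_n expr_div_n exprMn invf_div mulrA.
have ln4 : (ln (4 : R))%:C = 2 * (ln 2)%:C :> R[i].
  rewrite -natrC -rmorphM /=; congr (_%:C).
  have -> : (4 : R) = 2 ^+ 2 by ring.
  by rewrite lnXn // mulr_natl.
rewrite pw -expC_natM.
set X := expC (n%:R * (alpha * _)); set E := expC (n%:R * alpha + _ - _).
set F := expC (block_exponent n); set T := expC ((alpha ^+ 2 - alpha) / 2 * _ + _ - _ - _).
have -> : expC (D n) = X / E / F / T.
  rewrite /X /E /F /T -!expCB; congr expC; rewrite /D /block_exponent ln4.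
  by field.
have [x0 [e0 [f0 t0]]] : X != 0 /\ E != 0 /\ F != 0 /\ T != 0 by rewrite !expC_neq0.
have u0 : U n != 0.
  have : U n * F != 0 by rewrite -ratioB_block_prod; apply/prodf_neq0 => k _; rewrite mulf_neq0 ?invr_eq0 ?ratioB_neq0.
  by rewrite mulf_eq0 negb_or => /andP[].
have s0 : shift_ratio n ^+ n != 0.
  by rewrite expf_neq0 // mulf_neq0 ?invr_eq0 ?alphaH_neq0 ?halfS_neq0.
have b0 : B n ^+ n != 0 by rewrite expf_neq0 ?ratioB_neq0.
have h0 : H n ^+ n != 0 by rewrite expf_neq0 ?ratioH_neq0.
move: x0 e0 f0 t0 u0 s0 b0 h0 G0.
clear cG lim1; clearbody G; move: X E F T (U n) (shift_ratio n ^+ n) (B n ^+ n) (H n ^+ n) G (phi ^+ n) (\prod_(k < n) _).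
move=> X E F T u s b h G' p P x0 e0 f0 t0 u0 s0 b0 h0 G0.
by field; rewrite x0 e0 f0 t0 u0 s0 b0 h0 G0.
Qed.
End Asymp.

(** * Improper integrals over a period *)
Section Improper.
Variable R : realType.
Notation mu := (@lebesgue_measure R).
Notation L := (2 * pi : R).
Notation D := (`]0, L[%classic : set R).

Definition cutoff (n : nat) : R := n.+1%:R^-1.

Lemma cutoff_gt0 n : 0 < cutoff n. Proof. by rewrite /cutoff invr_gt0. Qed.
Lemma cutoff_le1 n : cutoff n <= 1.
Proof. by rewrite /cutoff invf_le1 ?ler1n. Qed.
Lemma cutoff_noninc n m : (n <= m)%N -> cutoff m <= cutoff n.
Proof. by move=> nm; rewrite /cutoff lef_pV2 ?posrE // ler_nat. Qed.
Lemma period_ge4 : 4 <= L. Proof. by have := pi_ge2 R; lra. Qed.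
Lemma cutoff_lt n : cutoff n < L - cutoff n.
Proof. by have := cutoff_le1 n; have := period_ge4; lra. Qed.

(** The endpoints of the period, where the symbol may be singular, are cut off. *)
Definition trunc_itv n : set R := `[cutoff n, L - cutoff n]%classic.

Lemma trunc_itv_sub n t : trunc_itv n t -> 0 < t < L.
Proof.
rewrite /trunc_itv /= in_itv /= => /andP[h1 h2]; have := cutoff_gt0 n => e0.
by apply/andP; split; [exact: lt_le_trans h1 | apply: le_lt_trans h2 _; lra].
Qed.

Lemma trunc_itv_nondecreasing : nondecreasing_seq trunc_itv.
Proof.
move=> n m nm; rewrite subsetEset => t; rewrite /trunc_itv /= !in_itv /= => /andP[h1 h2].
by have := cutoff_noninc nm => e; apply/andP; split; lra.
Qed.

Lemma trunc_itv_eventually t : 0 < t < L -> exists N, forall n, (N <= n)%N -> trunc_itv n t.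
Proof.
move=> /andP[t0 tL].
have [N hN] : exists N, cutoff N <= Num.min t (L - t).
  have m0 : 0 < Num.min t (L - t) by rewrite lt_min t0 subr_gt0.
  exists (Num.bound (Num.min t (L - t))^-1).
  rewrite /cutoff invf_ple ?posrE ?invr_gt0 // ltW // (lt_trans (archi_boundP _)) ?ltr_nat //.
  by rewrite invr_ge0 ltW.
exists N => n Nn; have := cutoff_noninc Nn; move: hN; rewrite le_min => /andP[h1 h2] h3.
by rewrite /trunc_itv /= in_itv /=; apply/andP; split; lra.
Qed.

Lemma bigcup_trunc_itv : \bigcup_n trunc_itv n = D.
Proof.
apply/seteqP; split => t /=.
  by move=> [n _] /trunc_itv_sub; rewrite in_itv.
by rewrite in_itv /= => /trunc_itv_eventually[N hN]; exists N => //; apply: hN.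
Qed.

Lemma measurable_trunc_itv n : measurable (trunc_itv n : set (measurableTypeR R)). Proof. exact: measurable_itv. Qed.
Lemma measurable_period : measurable (D : set (measurableTypeR R)). Proof. exact: measurable_itv. Qed.

Lemma derivable_cont (f : R -> R) (t : R) : derivable f t 1 -> {for t, continuous f}.
Proof. by move=> /derivable1_diffP; exact: differentiable_continuous. Qed.

Lemma measurable_of_derivable (f : R -> R) :
  (forall t, 0 < t < L -> derivable f t 1) -> measurable_fun D f.
Proof.
move=> h; apply: open_continuous_measurable_fun.
  exact: interval_open.
by move=> t; rewrite inE /= in_itv /= => tD; apply: derivable_cont; apply: h.
Qed.

Lemma integral_trunc_itv (F f : R -> R) n :
  (forall t, 0 < t < L -> is_derive t 1 F (f t)) ->
  (forall t, 0 < t < L -> derivable f t 1) ->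
  (\int[mu]_(x in trunc_itv n) (f x)%:E = (F (L - cutoff n))%:E - (F (cutoff n))%:E)%E.
Proof.
move=> dF df.
have AD t : cutoff n <= t <= L - cutoff n -> 0 < t < L by move=> h; apply: (@trunc_itv_sub n); rewrite /trunc_itv /= in_itv.
have e0 := cutoff_lt n.
apply: continuous_FTC2 => //.
- apply: derivable_within_continuous => t; rewrite in_itv /= => h.
  by apply: df; apply: AD.
- have cF t : cutoff n <= t <= L - cutoff n -> {for t, continuous F}.
    by move=> h; apply: derivable_cont; have [] := dF t (AD t h).
  split.
  + move=> t; rewrite in_itv /= => /andP[h1 h2].
    by have [] := dF t (AD t _); rewrite ?ltW.
  + apply: cvg_at_right_filter; apply: cF; rewrite lexx /=; exact: ltW.
  + apply: cvg_at_left_filter; apply: cF; rewrite lexx andbT; exact: ltW.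
- move=> t; rewrite in_itv /= => /andP[h1 h2]; rewrite derive1E.
  by have [] := dF t (AD t _); rewrite ?ltW.
Qed.

(** The integrals over the truncated periods are bounded by 2 K, and monotone
    convergence carries the bound over to the whole period. *)
Lemma integrable_of_primitive (g G dG : R -> R) (K : R) :
  (forall t, 0 < t < L -> derivable g t 1) ->
  (forall t, 0 < t < L -> derivable dG t 1) ->
  (forall t, 0 < t < L -> is_derive t 1 G (dG t)) ->
  (forall t, 0 < t < L -> 0 <= g t <= dG t) ->
  (forall t, 0 < t < L -> `|G t| <= K) ->
  mu.-integrable D (EFin \o g).
Proof.
move=> dg ddG hG gG GK.
have mg := measurable_of_derivable dg; have mdG := measurable_of_derivable ddG.
have AD n : trunc_itv n `<=` D by move=> t /trunc_itv_sub; rewrite /= in_itv.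
apply/integrableP; split; first exact/measurable_EFinP.
have -> : (\int[mu]_(x in D) `|(EFin \o g) x| = \int[mu]_(x in D) (g x)%:E)%E.
  apply: eq_integral => t; rewrite inE /= in_itv /= => tD.
  by rewrite ger0_norm //; have /andP[] := gG t tD.
have c := @ge0_nondecreasing_set_cvg_integral _ (measurableTypeR R) R trunc_itv (fun x => (g x)%:E) mu trunc_itv_nondecreasing measurable_trunc_itv _ _.
have {}c : (\int[mu]_(x in trunc_itv i) (g x)%:E @[i --> \oo] --> \int[mu]_(x in D) (g x)%:E)%E.
  rewrite -bigcup_trunc_itv; apply: c.
    by move=> n; apply/measurable_EFinP; apply: measurable_funS mg => //; exact: measurable_period.
  by move=> n x /trunc_itv_sub xD; rewrite lee_fin; have /andP[] := gG x xD.
apply: (@le_lt_trans _ _ (2 * K)%:E); last exact: ltry.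
rewrite -(cvg_lim _ c) //; apply: lime_le; first by apply/cvg_ex; eexists; exact: c.
near=> n.
apply: (@le_trans _ _ (\int[mu]_(x in trunc_itv n) (dG x)%:E)%E).
  apply: ge0_le_integral => //; first exact: measurable_trunc_itv.
  - by move=> x /trunc_itv_sub xD; rewrite lee_fin; have /andP[] := gG x xD.
  - by apply/measurable_EFinP; apply: measurable_funS mg => //; exact: measurable_period.
  - by apply/measurable_EFinP; apply: measurable_funS mdG => //; exact: measurable_period.
  - by move=> x /trunc_itv_sub xD; rewrite lee_fin; have /andP[] := gG x xD.
rewrite (integral_trunc_itv n hG ddG) -EFinB lee_fin.
have e0 := cutoff_gt0 n; have e1 := cutoff_lt n.
have := GK (L - cutoff n); have := GK (cutoff n).
rewrite !ler_norml => h1 h2.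
have /andP[? ?] : - K <= G (cutoff n) <= K by apply: h1; apply/andP; split; lra.
have /andP[? ?] : - K <= G (L - cutoff n) <= K by apply: h2; apply/andP; split; lra.
lra.
Unshelve. all: by end_near. Qed.

Lemma Rintegral_derivative0 (F f : R -> R) :
  (forall t, 0 < t < L -> is_derive t 1 F (f t)) ->
  (forall t, 0 < t < L -> derivable f t 1) ->
  mu.-integrable D (EFin \o f) ->
  (fun n => F (cutoff n)) @ \oo --> (0 : R) -> (fun n => F (L - cutoff n)) @ \oo --> (0 : R) ->
  \int[mu]_(x in D) f x = 0.
Proof.
move=> dF df fi F0 FL.
have mf := measurable_of_derivable df.
pose fn n := (EFin \o f) \_ (trunc_itv n).
have AD n : trunc_itv n `<=` D by move=> t /trunc_itv_sub; rewrite /= in_itv.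
have c : (\int[mu]_(x in D) fn n x @[n --> \oo] --> \int[mu]_(x in D) (EFin \o f) x)%E.
  apply: (@dominated_cvg _ (measurableTypeR R) R mu D measurable_period fn (EFin \o f) (abse \o (EFin \o f))).
  - move=> n; apply/measurable_restrict; [exact: measurable_trunc_itv | exact: measurable_period |].
    by apply/measurable_EFinP; apply: measurable_funS mf => //; exact: measurable_period.
  - move=> x; rewrite /= in_itv /= => /trunc_itv_eventually[N hN]; apply: cvg_near_cst.
    exists N => // n /= /hN h; by rewrite /fn patchE mem_set.
  - by [].
  - exact: integrable_abse.
  - move=> n x _; rewrite /fn patchE; case: ifP => _ //=.
    by rewrite normr0 lee_fin.
have cE n : (\int[mu]_(x in D) fn n x = (F (L - cutoff n) - F (cutoff n))%:E)%E.
  rewrite /fn -integral_mkcondr EFinB -(integral_trunc_itv n dF df); congr integral.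
  by apply/seteqP; split => [t []|t At] //; split=> //; exact: AD At.
have c0 : (\int[mu]_(x in D) fn n x @[n --> \oo] --> (0 - 0)%:E)%E.
  under eq_fun do rewrite cE.
  by apply: cvg_EFin; [exact: nearW | exact: cvgB].
by rewrite /Rintegral (cvg_unique _ c c0) // subrr.
Qed.

End Improper.

(** * Powers of the symbol *)
Section Symbol.
Variable R : realType.
Notation mu := (@lebesgue_measure R).
Notation L := (2 * pi : R).
Notation D := (`]0, L[%classic : set R).

Definition symb (t : R) : R := 2 - 2 * cos t.
(** The power a of [symb t]; it is meant for 0 < t < 2 pi, where [symb t] is
    positive. *)
Definition symbX (a t : R) : R := expR (a * ln (symb t)).

Lemma symb_sin t : symb t = 4 * sin (t / 2) ^+ 2.
Proof.
have := cos_mulr2n (t / 2); rewrite -[t / 2 *+ 2]mulr_natr divfK ?pnatr_eq0 // /symb => ->.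
by rewrite cos2sin2; ring.
Qed.

Lemma symb_gt0 t : 0 < t < L -> 0 < symb t.
Proof.
move=> /andP[t0 tL]; rewrite symb_sin mulr_gt0 // exprn_gt0 // sin_gt0_pi //.
by apply/andP; split; lra.
Qed.

Lemma symb_le4 t : symb t <= 4.
Proof. by rewrite /symb; have := cos_geN1 t; lra. Qed.

Lemma sin_sqr t : sin t ^+ 2 = symb t * (4 - symb t) / 4.
Proof. by rewrite sin2cos2 /symb; field. Qed.

Lemma symbXD a b t : symbX (a + b) t = symbX a t * symbX b t.
Proof. by rewrite /symbX mulrDl expRD. Qed.

Lemma symbX1 t : 0 < t < L -> symbX 1 t = symb t.
Proof. by move=> h; rewrite /symbX mul1r lnK // posrE symb_gt0. Qed.

Lemma symbX_gt0 a t : 0 < symbX a t. Proof. exact: expR_gt0. Qed.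

Lemma symbX_le a t : 0 <= a -> 0 < t < L -> symbX a t <= expR (a * ln 4).
Proof.
move=> a0 h; rewrite ler_expR ler_wpM2l // ler_ln ?posrE ?symb_gt0 //.
exact: symb_le4.
Qed.

Lemma is_derive_symb (t : R) : is_derive t 1 symb (2 * sin t).
Proof.
rewrite /symb [X in is_derive _ _ X _](_ : _ = cst 2 - 2 *: cos); last by apply/funext.
by apply: is_derive_eq; rewrite /GRing.scale /=; ring.
Qed.

Lemma is_derive_ln_symb (t : R) : 0 < t < L ->
  is_derive t 1 (@ln R \o symb) ((symb t)^-1 * (2 * sin t)).
Proof.
move=> h; apply: is_derive1_comp; last exact: is_derive_symb.
by apply: is_derive1_ln; exact: symb_gt0.
Qed.

Lemma is_derive_symbX (a t : R) : 0 < t < L ->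
  is_derive t 1 (symbX a) (symbX a t * (a * ((symb t)^-1 * (2 * sin t)))).
Proof.
move=> h; have d := is_derive_ln_symb h.
rewrite [X in is_derive _ _ X _](_ : _ = expR \o (a *: (@ln R \o symb))); last first.
  by apply/funext.
have d2 : is_derive t 1 (a *: (@ln R \o symb)) (a *: ((symb t)^-1 * (2 * sin t))) by exact: is_deriveZ.
by apply: is_derive1_comp.
Qed.

Lemma derivable_symbX (a t : R) : 0 < t < L -> derivable (symbX a) t 1.
Proof. by move=> /(is_derive_symbX a)[]. Qed.

(** For u = 2 - 2 cos t one has
    (u^a sin t)' = (2 a + 1) u^a - (a + 1) / 2 * u^(a + 1). The coefficient of the
    singular term u^a is positive, the other term is bounded, and u^a sin t is
    bounded because (sin t)^2 <= u. *)
Lemma symbX_integrable a : - (1 / 2) < a -> mu.-integrable D (EFin \o symbX a).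
Proof.
move=> ha; have a1 : 0 < 2 * a + 1 by lra.
pose C := (a + 1) / 2 * expR ((a + 1) * ln 4).
(* C bounds (a + 1) / 2 * u^(a + 1); adding C t makes the derivative of G
   dominate u^a. *)
pose G t := (2 * a + 1)^-1 * (symbX a t * sin t + C * t).
pose dG t := (2 * a + 1)^-1 * ((2 * a + 1) * symbX a t - (a + 1) / 2 * symbX (a + 1) t + C).
pose B := expR ((2 * a + 1) * ln 4).
have C0 : 0 <= C by rewrite mulr_ge0 ?expR_ge0 //; lra.
apply: (@integrable_of_primitive R (symbX a) G dG ((2 * a + 1)^-1 * (1 + B + C * L))).
- by move=> t; apply: derivable_symbX.
- move=> t h; rewrite /dG.
  have d1 := is_derive_symbX a h; have d2 := is_derive_symbX (a + 1) h.
  rewrite [X in derivable X _ _](_ : _ = (2 * a + 1)^-1 *: ((2 * a + 1) *: symbX a - ((a + 1) / 2) *: symbX (a + 1) + cst C)); last by apply/funext.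
  by apply: ex_derive.
- move=> t h; rewrite /G; have d1 := is_derive_symbX a h.
  rewrite [X in is_derive _ _ X _](_ : _ = (2 * a + 1)^-1 *: (symbX a * sin + C *: id)); last by apply/funext.
  have d3 : is_derive t 1 (C *: (@id R)) (C *: 1) by apply: is_deriveZ.
  have d4 := is_deriveZ (2 * a + 1)^-1 (is_deriveD (is_deriveM d1 (is_derive_sin t)) d3).
  apply: (is_derive_eq d4); rewrite /GRing.scale /= /dG; congr (_ * _).
  have u0 := symb_gt0 h; rewrite symbXD symbX1 //.
  have -> : sin t * (symbX a t * (a * ((symb t)^-1 * (2 * sin t)))) = symbX a t * a * 2 / symb t * sin t ^+ 2 by ring.
  rewrite sin_sqr mulr1.
  have -> : cos t = 1 - symb t / 2 by rewrite /symb; field.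
  by field; rewrite gt_eqF.
- move=> t h; rewrite ltW ?symbX_gt0 //= /dG.
  have : symbX (a + 1) t <= expR ((a + 1) * ln 4) by apply: symbX_le => //; lra.
  move=> h2; rewrite ler_pdivlMl //.
  have : (a + 1) / 2 * symbX (a + 1) t <= C by rewrite ler_wpM2l //; lra.
  by lra.
- move=> t h; have /andP[t0 tL] := h.
  have i0 : 0 <= (2 * a + 1)^-1 by rewrite invr_ge0 ltW.
  rewrite /G normrM (ger0_norm i0) ler_wpM2l //.
  rewrite (le_trans (ler_normD _ _)) // lerD //; last first.
    rewrite ger0_norm; first by rewrite ler_wpM2l // ltW.
    by rewrite mulr_ge0 // ltW.
  have sq : (symbX a t * sin t) ^+ 2 <= B.
    rewrite exprMn sin_sqr.
    have -> : symbX a t ^+ 2 * (symb t * (4 - symb t) / 4) = symbX (2 * a + 1) t * ((4 - symb t) / 4).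
      rewrite -(symbX1 h) (_ : 2 * a + 1 = a + a + 1); last by ring.
      by rewrite !symbXD; field.
    have := symbX_le (ltW a1) h; have := symbX_gt0 (2 * a + 1) t; have := symb_gt0 h.
    have := symb_le4 t; rewrite -/B; nra.
  set x := symbX a t * sin t in sq *.
  rewrite ler_norml; apply/andP; split; nra.
Qed.

End Symbol.

(** * Fourier coefficients of the symbol *)
Section FourierIntegrals.
Variable R : realType.
Notation mu := (@lebesgue_measure R).
Notation L := (2 * pi : R).
Notation D := (`]0, L[%classic : set R).
Notation ii := (0 +i* 1 : R[i]).

Definition integrableC (f : R -> R[i]) :=
  mu.-integrable D (EFin \o (fun t => complex.Re (f t))) /\
  mu.-integrable D (EFin \o (fun t => complex.Im (f t))).

Lemma integrableCD f g : integrableC f -> integrableC g -> integrableC (fun t => f t + g t).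
Proof.
move=> [f1 f2] [g1 g2]; split.
- rewrite [X in integrable _ _ X](_ : _ = (EFin \o (fun t => complex.Re (f t))) \+ (EFin \o (fun t => complex.Re (g t)))); last first.
    by apply/funext => t /=; rewrite cReD EFinD.
  apply: integrableD => //; exact: measurable_period.
- rewrite [X in integrable _ _ X](_ : _ = (EFin \o (fun t => complex.Im (f t))) \+ (EFin \o (fun t => complex.Im (g t)))); last first.
    by apply/funext => t /=; rewrite cImD EFinD.
  apply: integrableD => //; exact: measurable_period.
Qed.

Lemma integralCD f g : integrableC f -> integrableC g ->
  integralC D (fun t => f t + g t) = integralC D f + integralC D g.
Proof.
move=> [f1 f2] [g1 g2]; rewrite /integralC; apply: eqC_ReIm => /=.
- rewrite -(RintegralD (@measurable_period R) f1 g1); apply: eq_Rintegral => t _; exact: cReD.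
- rewrite -(RintegralD (@measurable_period R) f2 g2); apply: eq_Rintegral => t _; exact: cImD.
Qed.

Lemma integrable_scale (f : R -> R) (c : R) : mu.-integrable D (EFin \o f) ->
  mu.-integrable D (EFin \o (fun t => c * f t)).
Proof.
move=> h; rewrite [X in integrable _ _ X](_ : _ = (fun t => c%:E * (EFin \o f) t)%E); last first.
  by apply/funext => t /=; rewrite EFinM.
apply: integrableZl => //; exact: measurable_period.
Qed.

Lemma integrable_sub (f g : R -> R) : mu.-integrable D (EFin \o f) ->
  mu.-integrable D (EFin \o g) -> mu.-integrable D (EFin \o (fun t => f t - g t)).
Proof.
move=> h1 h2; rewrite [X in integrable _ _ X](_ : _ = ((EFin \o f) \- (EFin \o g))%E); last first.
  by apply/funext => t /=; rewrite EFinB.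
apply: integrableB => //; exact: measurable_period.
Qed.

Lemma integrable_add (f g : R -> R) : mu.-integrable D (EFin \o f) ->
  mu.-integrable D (EFin \o g) -> mu.-integrable D (EFin \o (fun t => f t + g t)).
Proof.
move=> h1 h2; rewrite [X in integrable _ _ X](_ : _ = ((EFin \o f) \+ (EFin \o g))%E); last first.
  by apply/funext => t /=; rewrite EFinD.
apply: integrableD => //; exact: measurable_period.
Qed.

Lemma integrableCZ c f : integrableC f -> integrableC (fun t => c * f t).
Proof.
move=> [f1 f2]; split.
- rewrite (_ : (fun t => _) = (fun t => complex.Re c * complex.Re (f t) -
     complex.Im c * complex.Im (f t))); last by apply/funext => t; rewrite cReM.
  by apply: integrable_sub; apply: integrable_scale.
- rewrite (_ : (fun t => _) = (fun t => complex.Re c * complex.Im (f t) +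
     complex.Im c * complex.Re (f t))); last by apply/funext => t; rewrite cImM.
  by apply: integrable_add; apply: integrable_scale.
Qed.

Lemma integralCZ c f : integrableC f -> integralC D (fun t => c * f t) = c * integralC D f.
Proof.
move=> [f1 f2]; rewrite /integralC; apply: eqC_ReIm; rewrite ?cReM ?cImM /=.
- under eq_Rintegral do rewrite cReM.
  rewrite (RintegralB (@measurable_period R)); [|exact: integrable_scale|exact: integrable_scale].
  by rewrite !RintegralZl //; exact: measurable_period.
- under eq_Rintegral do rewrite cImM.
  rewrite (RintegralD (@measurable_period R)); [|exact: integrable_scale|exact: integrable_scale].
  by rewrite !RintegralZl //; exact: measurable_period.
Qed.

Lemma eq_integralC f g : (forall t, 0 < t < L -> f t = g t) -> integralC D f = integralC D g.
Proof.
move=> h; rewrite /integralC; congr (_ +i* _); apply: eq_Rintegral => t;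
  by rewrite inE /= in_itv /= => /h ->.
Qed.

Lemma integrableC_dominated f (df : R -> R[i]) a (C : R) : - (1 / 2) < a ->
  (forall t, 0 < t < L -> is_deriveC f t (df t)) ->
  (forall t, 0 < t < L -> normc (f t) <= C * symbX a t) -> integrableC f.
Proof.
move=> ha fd fC.
have gi := integrable_scale C (symbX_integrable ha).
split; apply: (le_integrable (@measurable_period R) _ _ gi).
- apply/measurable_EFinP; apply: measurable_of_derivable => t /fd[h _].
  by case: h.
- move=> t; rewrite /= in_itv /= => h; rewrite lee_fin (le_trans (le_Re_normc _)) //.
  by rewrite (le_trans (fC t h)) // ler_norm.
- apply/measurable_EFinP; apply: measurable_of_derivable => t /fd[_ h].
  by case: h.
- move=> t; rewrite /= in_itv /= => h; rewrite lee_fin (le_trans (le_Im_normc _)) //.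
  by rewrite (le_trans (fC t h)) // ler_norm.
Qed.

Definition integrand (alpha : R[i]) (k : int) (t : R) : R[i] :=
  powC (symb t) alpha * cis (- (k%:~R * t)).

Lemma is_deriveC_cis (c t : R) : is_deriveC (fun s => cis (- (c * s))) t (- (ii * c%:C) * cis (- (c * t))).
Proof.
rewrite cisE; under eq_fun do rewrite cisE; apply: is_deriveC_exp; split => /=.
  rewrite (_ : - _ = 0); last by rewrite !mul0r mulr0 subrr oppr0.
  exact: is_derive_cst.
rewrite [X in is_derive _ _ X _](_ : _ = (fun s => (- c) * s)); last first.
  by apply/funext => s; rewrite mulNr.
rewrite (_ : - _ = - c); last by rewrite mul0r mul1r add0r.
exact: is_derive_linear.
Qed.

Lemma is_deriveC_powC alpha (t : R) : 0 < t < L ->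
  is_deriveC (fun s => powC (symb s) alpha) t
    (alpha * ((symb t)^-1 * (2 * sin t))%:C * powC (symb t) alpha).
Proof.
move=> h; apply: is_deriveC_exp; apply: is_deriveC_eq.
  apply: is_deriveCM; first exact: is_deriveC_cst.
  exact: (is_deriveC_real (is_derive_ln_symb h)).
by rewrite mul0r add0r.
Qed.

Definition dintegrand alpha k t := (alpha * ((symb t)^-1 * (2 * sin t))%:C - ii * (k%:~R)) * integrand alpha k t.

Lemma intrC (k : int) : (k%:~R : R)%:C = k%:~R :> R[i].
Proof. by rewrite (rmorph_int (real_complex R)). Qed.

Lemma is_deriveC_integrand alpha k (t : R) : 0 < t < L -> is_deriveC (integrand alpha k) t (dintegrand alpha k t).
Proof.
move=> h; apply: is_deriveC_eq.
  by apply: is_deriveCM; [exact: is_deriveC_powC | exact: is_deriveC_cis].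
by rewrite /dintegrand /integrand intrC; ring.
Qed.

Lemma normc_powC alpha (t : R) : normc (powC (symb t) alpha) = symbX (complex.Re alpha) t.
Proof. by rewrite /powC normc_expC cReM /= mulr0 subr0. Qed.

Lemma normc_integrand alpha k t : normc (integrand alpha k t) = symbX (complex.Re alpha) t.
Proof. by rewrite /integrand normcM normc_cis mulr1 normc_powC. Qed.

Lemma integrand_integrable alpha k : - (1 / 2) < complex.Re alpha -> integrableC (integrand alpha k).
Proof.
move=> ha; apply: (@integrableC_dominated _ (dintegrand alpha k) (complex.Re alpha) 1) => //.
  by move=> t; apply: is_deriveC_integrand.
by move=> t _; rewrite normc_integrand mul1r.
Qed.

(** The derivative of u^alpha (z^-k - z^(-k-1)) with z = e^(it), using
    u' = 2 sin t and 2 sin t (1 - 1/z) = i u (1 + 1/z). *)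
Lemma integrand_recurrence alpha k t : 0 < t < L ->
  dintegrand alpha k t - dintegrand alpha (k + 1) t =
  ii * ((alpha - k%:~R) * integrand alpha k t + (alpha + k%:~R + 1) * integrand alpha (k + 1) t).
Proof.
move=> h; have u0 := symb_gt0 h.
have -> : integrand alpha k t = integrand alpha (k + 1) t * cis t.
  rewrite /integrand -mulrA -cisD; congr (_ * cis _); rewrite rmorphD /=; ring.
rewrite /dintegrand.
have -> : integrand alpha k t = integrand alpha (k + 1) t * cis t.
  rewrite /integrand -mulrA -cisD; congr (_ * cis _); rewrite rmorphD /=; ring.
set K := integrand _ _ _; rewrite rmorphD /=.
(* (sin t / (1 - cos t)) (z - 1) = i (z + 1), the half-angle cotangent. *)
have key : ((symb t)^-1 * (2 * sin t))%:C * (cis t - 1) = ii * (cis t + 1).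
  have un : symb t != 0 by rewrite gt_eqF.
  apply: (@mulfI _ (symb t)%:C); first by rewrite (inj_eq (@complexI R)).
  rewrite mulrA -rmorphM /= mulrA divff // mul1r.
  apply: eqC_ReIm; rewrite !(cReM, cImM, cReD, cImD, cReN, cImN) /= /symb.
    by have := sin2cos2 t; rewrite expr2 => ?; ring.
  have := sin2cos2 t; rewrite !expr2 => ?; nra.
have e : K * alpha * (((symb t)^-1 * (2 * sin t))%:C * (cis t - 1)) = K * alpha * (ii * (cis t + 1)).
  by rewrite key.
rewrite rmorph1 in e *; move: e; set S := (_ * _)%:C; move: (cis t) => z e.
have -> : (alpha * S - ii * k%:~R) * (K * z) - (alpha * S - ii * (k%:~R + 1)) * K =
   K * alpha * (S * (z - 1)) - ii * k%:~R * K * z + ii * (k%:~R + 1) * K by ring.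
by rewrite e; ring.
Qed.

(** 2 pi times the k-th Fourier coefficient of u^alpha. *)
Definition fourier_int alpha k := integralC D (integrand alpha k).

Lemma cutoff_range n : 0 < cutoff R n < L.
Proof. by have := cutoff_gt0 R n; have := cutoff_le1 R n; have := period_ge4 R; lra. Qed.
Lemma sub_cutoff_range n : 0 < L - cutoff R n < L.
Proof. by have := cutoff_gt0 R n; have := cutoff_le1 R n; have := period_ge4 R; lra. Qed.

Lemma symb_sym t : symb (L - t) = symb t.
Proof.
rewrite !symb_sin (_ : (L - t) / 2 = pi - t / 2); last by field.
by rewrite sinB sinpi cospi; congr (_ * _ ^+ 2); ring.
Qed.

Lemma symb_cutoff_cvg : (fun n => symb (cutoff R n)) @ \oo --> (0 : R).
Proof.
have c : {for 0, continuous (@symb R)}.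
  by apply: derivable_cont; have [] := is_derive_symb (0 : R).
have -> : 0 = symb (0 : R) by rewrite /symb cos0; ring.
have h : (fun n => cutoff R n) @ \oo --> (0 : R) by exact: (@cvg_harmonic R).
exact: (cvg_comp _ _ h c).
Qed.

Lemma symbX_cutoff_cvg (c : R) : 0 < c -> (fun n => symbX c (cutoff R n)) @ \oo --> (0 : R).
Proof.
move=> c0; apply/cvgrPdist_le => e e0.
have [N _ hN] := (cvgrPdist_le _ _).1 symb_cutoff_cvg _ (expR_gt0 (ln e / c)).
exists N => // n /= Nn; rewrite sub0r normrN ger0_norm ?expR_ge0 //.
have u0 := symb_gt0 (cutoff_range n).
have := hN n Nn; rewrite sub0r normrN ger0_norm ?(ltW u0) // => h.
rewrite /symbX -[leRHS](lnK (x := e)) ?posrE // ler_expR mulrC -ler_pdivlMr //.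
by rewrite -ler_expR lnK ?posrE.
Qed.

Lemma symbX_sym c t : symbX c (L - t) = symbX c t.
Proof. by rewrite /symbX symb_sym. Qed.

(** |1 - z|^2 = u on the unit circle; so the antiderivative in
    [integrand_recurrence] vanishes at both ends of the period as soon as
    Re alpha > - 1/2. *)
Lemma normc_integrandB alpha k t : 0 < t < L ->
  normc (integrand alpha k t - integrand alpha (k + 1) t) = symbX (complex.Re alpha + 1 / 2) t.
Proof.
move=> h; have -> : integrand alpha (k + 1) t = integrand alpha k t * cis (- t).
  by rewrite /integrand -mulrA -cisD; congr (_ * cis _); rewrite rmorphD /=; ring.
rewrite -{1}[integrand alpha k t]mulr1 -mulrBr normcM normc_integrand symbXD; congr (_ * _).
apply/eqP; rewrite -(eqrXn2 (n := 2)) ?normc_ge0 ?expR_ge0 // [X in _ == X]expr2 -symbXD.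
rewrite (_ : 1 / 2 + 1 / 2 = 1); last by field.
rewrite symbX1 // normc_sqr cReB cImB /= cosN sinN /symb sub0r opprK.
by apply/eqP; rewrite sin2cos2; ring.
Qed.

Lemma fourier_int_rec alpha k : - (1 / 2) < complex.Re alpha ->
  (alpha - k%:~R) * fourier_int alpha k + (alpha + k%:~R + 1) * fourier_int alpha (k + 1) = 0.
Proof.
move=> ha; have i1 := integrand_integrable k ha; have i2 := integrand_integrable (k + 1) ha.
pose X t := (alpha - k%:~R) * integrand alpha k t + (alpha + k%:~R + 1) * integrand alpha (k + 1) t.
pose F t := integrand alpha k t - integrand alpha (k + 1) t.
have iX : integrableC X by apply: integrableCD; apply: integrableCZ.
have iiX := integrableCZ ii iX.
rewrite -(integralCZ _ i1) -(integralCZ _ i2) -integralCD; try exact: integrableCZ.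
have ii0 : ii != 0 by rewrite eq_complex /= oner_eq0 andbF.
apply: (mulfI ii0); rewrite mulr0 -integralCZ //.
have dF t : 0 < t < L -> is_deriveC F t (ii * X t).
  move=> h; rewrite -integrand_recurrence //.
  apply: is_deriveC_eq; first apply: is_deriveCD; first exact: is_deriveC_integrand.
    under eq_fun do rewrite -mulN1r.
    by apply: is_deriveCM; [exact: is_deriveC_cst | exact: is_deriveC_integrand].
  by rewrite mul0r add0r mulN1r.
have dX t : 0 < t < L -> exists d, is_deriveC (fun s => ii * X s) t d.
  move=> h; eexists; apply: is_deriveCM; first exact: is_deriveC_cst.
  by apply: is_deriveCD; apply: is_deriveCM; try exact: is_deriveC_cst; exact: is_deriveC_integrand.
have c0 : 0 < complex.Re alpha + 1 / 2 by lra.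
have lim (p : R[i] -> R) (t_ : nat -> R) : (forall z, `|p z| <= normc z) ->
    (forall n, 0 < t_ n < L) -> (forall n c, symbX c (t_ n) = symbX c (cutoff R n)) ->
    (fun n => p (F (t_ n))) @ \oo --> (0 : R).
  move=> hp ht hs; have h := symbX_cutoff_cvg c0.
  apply/cvgrPdist_le => e /((cvgrPdist_le _ _).1 h)[N _ hN]; exists N => // n /= Nn.
  have := hN n Nn; rewrite !sub0r !normrN ger0_norm ?expR_ge0 // => h2.
  by rewrite (le_trans (hp _)) // /F normc_integrandB // hs.
rewrite /integralC; apply: eqC_ReIm => /=.
- apply: (@Rintegral_derivative0 R (fun t => complex.Re (F t))).
  + by move=> t h; exact: (dF t h).1.
  + by move=> t /dX[d [[h _] _]].
  + exact: iiX.1.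
  + by apply: lim => //; [exact: le_Re_normc | exact: cutoff_range].
  + apply: (lim _ (fun n => L - cutoff R n)); [exact: le_Re_normc | exact: sub_cutoff_range |].
    by move=> n c; exact: symbX_sym.
- apply: (@Rintegral_derivative0 R (fun t => complex.Im (F t))).
  + by move=> t h; exact: (dF t h).2.
  + by move=> t /dX[d [_ [h _]]].
  + exact: iiX.2.
  + by apply: lim => //; [exact: le_Im_normc | exact: cutoff_range].
  + apply: (lim _ (fun n => L - cutoff R n)); [exact: le_Im_normc | exact: sub_cutoff_range |].
    by move=> n c; exact: symbX_sym.
Qed.

(** The recurrence [fourier_int_rec] is invariant under k |-> - k - 1. *)
Lemma fourier_int_even alpha k : - (1 / 2) < complex.Re alpha -> fourier_int alpha (- k) = fourier_int alpha k.
Proof.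
move=> ha; have H (n : nat) : fourier_int alpha (- n%:Z) = fourier_int alpha n%:Z.
  elim: n => [|n IH]; first by rewrite oppr0.
  have a0 : alpha + n%:R + 1 != 0 by exact: alphaS_neq0.
  have e1 : (alpha - n%:R) * fourier_int alpha n%:Z + (alpha + n%:R + 1) * fourier_int alpha (n%:Z + 1) = 0 := fourier_int_rec n ha.
  have e2 := fourier_int_rec (- (n.+1%:Z)) ha.
  have nE : - n.+1%:Z + 1 = - n%:Z by lia.
  have nE2 : n.+1%:Z = n%:Z + 1 by lia.
  rewrite nE IH in e2; rewrite nE2 in e2 *.
  apply: (mulfI a0); apply: (addrI ((alpha - n%:R) * fourier_int alpha n%:Z)); rewrite e1 -[RHS]e2.
  by rewrite !rmorphN rmorphD /= -[n%:Z%:~R]/(n%:R); ring.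
by case: (intP k) => [|n|n]; rewrite ?oppr0 ?opprK ?H.
Qed.

Lemma integrand_shift alpha k t : 0 < t < L ->
  integrand (alpha + 1) k t = (symb t)%:C * integrand alpha k t.
Proof.
move=> h; rewrite /integrand /powC mulrDl mul1r expCD expCR lnK ?posrE ?symb_gt0 //; ring.
Qed.

(** u = 2 - z - 1/z, and [fourier_int_rec] expresses the coefficients of index
    1 and -1 through that of index 0. *)
Lemma fourier_int_shift alpha : - (1 / 2) < complex.Re alpha ->
  fourier_int (alpha + 1) 0 * (alpha + 1) = 2 * (2 * alpha + 1) * fourier_int alpha 0.
Proof.
move=> ha; have i k := integrand_integrable k ha.
have -> : fourier_int (alpha + 1) 0 = 2 * fourier_int alpha 0 + (- 1) * fourier_int alpha 1 + (- 1) * fourier_int alpha (- 1).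
  rewrite /fourier_int -!integralCZ // -!integralCD; try by do ?apply: integrableCD; exact: integrableCZ.
  apply: eq_integralC => t h; rewrite integrand_shift //.
  rewrite /integrand !mulr0z mul0r oppr0 mulrN1z mulr1z !mulN1r !mul1r opprK.
  have -> : cis (0 : R) = 1 by rewrite /cis cos0 sin0.
  have -> : (symb t)%:C = 2 - cis t - cis (- t).
    apply: eqC_ReIm; rewrite !(cReB, cImB) -natrC /= ?cosN ?sinN /symb; ring.
  ring.
rewrite fourier_int_even //; have := fourier_int_rec 0 ha; rewrite add0r mulr0z subr0 addr0 => e.
have -> : (2 * fourier_int alpha 0 + -1 * fourier_int alpha 1 + -1 * fourier_int alpha 1) * (alpha + 1) =
  2 * fourier_int alpha 0 * (alpha + 1) - 2 * (alpha * fourier_int alpha 0 + (alpha + 1) * fourier_int alpha 1)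
   + 2 * alpha * fourier_int alpha 0 by ring.
by rewrite e; ring.
Qed.

End FourierIntegrals.

(** * The constant Fourier coefficient *)
Section Laplace.
Variable R : realType.
Notation mu := (@lebesgue_measure R).
Notation L := (2 * pi : R).
Notation D := (`]0, L[%classic : set R).

(** In the variable l = ln (u / 4) <= 0 the difference is 4^(alpha + 1) times
    e^((alpha + 1) l) - e^l, whose derivative is dominated by that of a multiple
    of e^(l / 2) because Re (alpha + 1) > 1/2. One power of u is kept as a factor so
    that the estimate holds down to u = 0. *)
Lemma powC_lipschitz (alpha : R[i]) (u : R) : - (1 / 2) < complex.Re alpha -> 0 < u <= 4 ->
  normc (powC u (alpha + 1) - powC 4 alpha * u%:C) <=
  normc (powC 4 (alpha + 1)) * (normc (alpha + 1) + 1) * (4 - u).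
Proof.
move=> ha /andP[u0 u4]; pose l := ln (u / 4).
have lE : ln u = l + ln 4 by rewrite /l ln_div ?posrE // subrK.
have l0 : l <= 0 by rewrite /l ln_le0 // ler_pdivrMr // mul1r.
pose K := normc (alpha + 1) + 1.
pose g (s : R) := expC ((alpha + 1) * s%:C) - expC (1 * s%:C).
pose dg (s : R) := (alpha + 1) * expC ((alpha + 1) * s%:C) - 1 * expC (1 * s%:C).
pose h (s : R) := 2 * K * expR (2^-1 * s).
pose dh (s : R) := K * expR (2^-1 * s).
have De z s : is_deriveC (fun s : R => expC (z * s%:C)) s (z * expC (z * s%:C)).
  apply: is_deriveC_exp; apply: is_deriveC_eq; first apply: is_deriveCM; first exact: is_deriveC_cst.
    by apply: is_deriveC_real; apply: is_derive_id.
  by rewrite mul0r add0r mulr1.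
have Dg s : is_deriveC g s (dg s).
  rewrite /g; under eq_fun do rewrite -[X in _ + X]mulN1r.
  apply: is_deriveC_eq; first apply: is_deriveCD; first exact: De.
    by apply: is_deriveCM; [exact: is_deriveC_cst | exact: De].
  by rewrite /dg mul0r add0r !mul1r mulN1r.
have Dh (s : R) : is_derive s 1 h (dh s).
  have d1 := is_derive_linear (2^-1 : R) s.
  have d2 := is_derive1_comp (is_derive_expR (2^-1 * s)) d1.
  have d3 := is_deriveZ (2 * K) d2.
  rewrite [X in is_derive _ _ X _](_ : _ = (2 * K) *: (expR \o (fun s => 2^-1 * s))); last by apply/funext.
  by apply: (is_derive_eq d3); rewrite /GRing.scale /= /dh; field.
have hle s : l <= s <= 0 -> normc (dg s) <= dh s.
  move=> /andP[ls s0]; rewrite /dg /dh (le_trans (normcB _ _)) // (normcM (alpha + 1)) (normcM 1) normc1 mul1r /K [_ * expR _]mulrDl !mul1r.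
  have e1 w : complex.Re w <= 2^-1 * s -> normc (expC w) <= expR (2^-1 * s).
    by rewrite normc_expC ler_expR.
  apply: lerD; last by apply: e1; rewrite ?cReM /= ?mul1r ?mul0r ?subr0; lra.
  rewrite ler_wpM2l ?normc_ge0 // e1 // cReM /= mulr0 subr0 ler_wnM2r // cReD /=.
  by move: ha; lra.
have := normc_increment_le l0 (fun s _ => Dg s) (fun s _ => Dh s) hle.
have -> : g 0 = 0 by rewrite /g !mulr0 expC0 subrr.
rewrite sub0r normcN /h mulr0 expR0 mulr1 => H.
have K0 : 0 <= K by rewrite addr_ge0 ?normc_ge0.
have el : expR l = u / 4 by rewrite /l lnK // posrE divr_gt0.
have e2 : u / 4 <= expR (2^-1 * l) by rewrite -el ler_expR; lra.
have -> : powC u (alpha + 1) - powC 4 alpha * u%:C = powC 4 (alpha + 1) * g l.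
  have e3 : powC u (alpha + 1) = powC 4 (alpha + 1) * expC ((alpha + 1) * l%:C).
    by rewrite /powC lE rmorphD /= mulrDr expCD mulrC.
  have e4 : powC 4 alpha * u%:C = powC 4 (alpha + 1) * expC (1 * l%:C).
    rewrite /powC mulrDl !mul1r expCD !expCR el lnK ?posrE // -mulrA; congr (_ * _).
    have -> : (u / 4)%:C = u%:C / 4 by rewrite rmorphM fmorphV /= natrC.
    by rewrite natrC mulrC divfK // pnatr_eq0.
  by rewrite e3 e4 /g mulrBr.
rewrite normcM -mulrA ler_wpM2l ?normc_ge0 // (le_trans H) // -/K.
move: (expR _) e2 => x; move: K0; nra.
Qed.

Lemma normc_integralC_le (f : R -> R[i]) (g : R -> R) : integrableC f ->
  mu.-integrable D (EFin \o g) -> (forall t, 0 < t < L -> normc (f t) <= g t) ->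
  normc (integralC D f) <= 2 * \int[mu]_(t in D) g t.
Proof.
move=> [f1 f2] gi fg; rewrite (le_trans (normc_le_ReIm _)) // /integralC /=.
have dbl (x : R) : 2 * x = x + x by ring.
rewrite [2 * (\int[mu]_(t in D) g t)]dbl.
have H (p : R -> R) : mu.-integrable D (EFin \o p) -> (forall t, 0 < t < L -> `|p t| <= g t) ->
    `|\int[mu]_(t in D) p t| <= \int[mu]_(t in D) g t.
  move=> pi pg; apply: le_trans (le_normr_Rintegral (@measurable_period R) pi) _.
  apply: le_Rintegral => //; first exact: integrable_norm.
by apply: lerD; apply: H => // t tD; rewrite (le_trans _ (fg t tD)) ?le_Re_normc ?le_Im_normc.
Qed.

(** 2 pi times the binomial coefficient of 2n over n. *)
Definition symb_moment (n : nat) : R := \int[mu]_(t in D) symbX n%:R t.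

Lemma natr_gt_half n : - (1 / 2) < complex.Re (n%:R : R[i]).
Proof. by rewrite cRe_nat; have := ler0n R n; lra. Qed.

Lemma fourier_int_nat n : fourier_int (n%:R : R[i]) 0 = (symb_moment n)%:C.
Proof.
have -> : fourier_int (n%:R : R[i]) 0 = integralC D (fun t => (symbX n%:R t)%:C).
  apply: eq_integralC => t h; rewrite /integrand mulr0z mul0r oppr0 /cis cos0 sin0 /powC.
  by rewrite -natrC -rmorphM /= expCR mulr1.
apply: eqC_ReIm => //=; by rewrite /Rintegral integral0.
Qed.

Lemma symb_moment_rec n : symb_moment n.+1 * (n%:R + 1) = 2 * (2 * n%:R + 1) * symb_moment n.
Proof.
apply: (@complexI R); rewrite !(rmorphM, rmorphD) /= rmorph1 !natrC -!fourier_int_nat -natr1.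
exact: fourier_int_shift (natr_gt_half n).
Qed.

Lemma symb_moment0 : symb_moment 0 = L.
Proof.
rewrite /symb_moment (@eq_Rintegral _ _ _ mu D (cst 1)); last by move=> t _; rewrite /symbX mul0r expR0.
rewrite Rintegral_cst; last exact: measurable_period.
have := lebesgue_measure_itv `]0, L[ => /= E; rewrite mul1r.
rewrite [X in fine X](_ : _ = L%:E) //; apply: etrans E _.
by rewrite lte_fin mulr_gt0 ?pi_gt0 // sube0.
Qed.

Lemma symb_moment_gt0 n : 0 < symb_moment n.
Proof.
elim: n => [|n IH]; first by rewrite symb_moment0 mulr_gt0 ?pi_gt0.
have n1 : 0 < n%:R + 1 :> R by rewrite ltr_wpDl.
rewrite -(pmulr_lgt0 _ n1) symb_moment_rec !mulr_gt0 //.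
Qed.

Variable alpha : R[i].
Hypothesis alpha_re : - (1 / 2) < complex.Re alpha.

Lemma re_shift n : - (1 / 2) < complex.Re (alpha + n%:R).
Proof. by rewrite cReD cRe_nat; have := ler0n R n; move: alpha_re; lra. Qed.

(** By [powC_lipschitz] the difference of u^(alpha + n + 1) and
    4^alpha u^(n + 1) is O(u^n (4 - u)), whose integral is
    4 [symb_moment n] - [symb_moment n.+1], that is [symb_moment n.+1] / (2n + 1). *)
Lemma fourier_int_laplace :
  cvgC (fun n => fourier_int (alpha + n%:R) 0 / (symb_moment n)%:C) (powC 4 alpha).
Proof.
pose C := normc (powC (4 : R) (alpha + 1)) * (normc (alpha + 1) + 1).
have C0 : 0 <= C by rewrite mulr_ge0 ?normc_ge0 ?addr_ge0 ?normc_ge0.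
have sI n : mu.-integrable D (EFin \o symbX (n%:R : R)).
  by apply: symbX_integrable; have := ler0n R n; lra.
have bound n : normc (fourier_int (alpha + n.+1%:R) 0 - powC 4 alpha * (symb_moment n.+1)%:C) <=
    2 * (C * (4 * symb_moment n - symb_moment n.+1)).
  pose g t : R := C * (4 * symbX n%:R t - symbX n.+1%:R t).
  have gi : mu.-integrable D (EFin \o g).
    by apply: integrable_scale; apply: integrable_sub => //; exact: integrable_scale.
  have -> : C * (4 * symb_moment n - symb_moment n.+1) = \int[mu]_(t in D) g t.
    rewrite /g RintegralZl; [|exact: measurable_period|].
      rewrite RintegralB; [|exact: measurable_period|exact: integrable_scale|exact: sI].
      by rewrite RintegralZl //; exact: measurable_period.
    by apply: integrable_sub => //; exact: integrable_scale.
  have i1 := integrand_integrable 0 (re_shift n.+1).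
  have i2 := integrand_integrable 0 (natr_gt_half n.+1).
  rewrite -fourier_int_nat /fourier_int -mulNr -integralCZ // -integralCD //; last exact: integrableCZ.
  apply: normc_integralC_le => //; first by apply: integrableCD => //; exact: integrableCZ.
  move=> t h; have u0 := symb_gt0 h.
  have -> : integrand (alpha + n.+1%:R) 0 t + - powC 4 alpha * integrand n.+1%:R 0 t =
     (symbX n%:R t)%:C * (powC (symb t) (alpha + 1) - powC 4 alpha * (symb t)%:C).
    rewrite /integrand mulr0z mul0r oppr0 /cis cos0 sin0 !mulr1.
    have -> : (symbX n%:R t)%:C = powC (symb t) n%:R by rewrite /powC -natrC -rmorphM expCR.
    have pD z w : powC (symb t) (z + w) = powC (symb t) z * powC (symb t) w.
      by rewrite /powC mulrDl expCD.
    have p1 : (symb t)%:C = powC (symb t) 1 by rewrite /powC mul1r expCR lnK ?posrE.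
    rewrite p1 -[n.+1%:R]natr1 !pD; ring.
  rewrite normcM normcR ger0_norm ?expR_ge0 //.
  have := @powC_lipschitz alpha (symb t) alpha_re; rewrite u0 symb_le4 => /(_ isT) lip.
  have -> : g t = symbX n%:R t * (C * (4 - symb t)).
    by rewrite /g -[n.+1%:R]natr1 symbXD symbX1 //; ring.
  by rewrite ler_wpM2l ?expR_ge0.
clearbody C.
apply: (@cvgC_squeeze _ _ _ (fun n => 2 * C * n%:R^-1) 1); last first.
  rewrite -(mulr0 (2 * C)); apply: cvgM; first exact: cvg_cst.
  rewrite -cvg_shiftS /=; exact: cvg_harmonic.
case=> [//|n] _; have c0 := symb_moment_gt0 n.+1; have c1 := symb_moment_gt0 n.
have cn : (symb_moment n.+1)%:C != 0 by rewrite (inj_eq (@complexI R)) gt_eqF.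
have -> : fourier_int (alpha + n.+1%:R) 0 / (symb_moment n.+1)%:C - powC 4 alpha =
   (fourier_int (alpha + n.+1%:R) 0 - powC 4 alpha * (symb_moment n.+1)%:C) / (symb_moment n.+1)%:C by field.
rewrite normcM normcV normcR (ger0_norm (ltW c0)) ler_pdivrMr // (le_trans (bound n)) //.
rewrite -!mulrA ler_wpM2l // ler_wpM2l //.
have n0 : 0 <= n%:R :> R by [].
have n1 : 0 < n%:R + 1 :> R by rewrite ltr_wpDl.
have rec := symb_moment_rec n; rewrite -[n.+1%:R]natr1.
have -> : symb_moment n = (n%:R + 1) / (2 * (2 * n%:R + 1)) * symb_moment n.+1.
  rewrite mulrAC [_ * symb_moment n.+1]mulrC rec.
  by field; rewrite gt_eqF // ltr_wpDl // mulr_ge0.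
rewrite mulrA -{2}[symb_moment n.+1]mul1r -mulrBl ler_pM2r //.
have n2 : 0 < 2 * n%:R + 1 :> R by rewrite ltr_wpDl // mulr_ge0.
have -> : 4 * ((n%:R + 1) / (2 * (2 * n%:R + 1))) - 1 = (2 * n%:R + 1)^-1 :> R.
  by field; rewrite gt_eqF.
rewrite lef_pV2 ?posrE //; lra.
Qed.

(** The factors in [fourier_int_shift] at alpha + n and at n are those of B and H. *)
Lemma fourier_int_product n :
  ratioB alpha n / ratioH alpha n * (fourier_int (alpha + n%:R) 0 / (symb_moment n)%:C) =
  fourier_int alpha 0 / L%:C.
Proof.
elim: n => [|n IH].
  by rewrite /ratioB /ratioH !big_ord0 addr0 symb_moment0 divr1 mul1r.
rewrite -IH (ratioB_S alpha n) (ratioH_S alpha n).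
have cn : (symb_moment n)%:C != 0 by rewrite (inj_eq (@complexI R)) gt_eqF // symb_moment_gt0.
have cn1 : (symb_moment n.+1)%:C != 0 by rewrite (inj_eq (@complexI R)) gt_eqF // symb_moment_gt0.
have h1 := alphaS_neq0 alpha_re n; have h2 := alphaH_neq0 alpha_re n.
have h3 := halfS_neq0 R n; have h4 := natS_neq0 R n; have h5 := ratioB_neq0 alpha_re n.
have h6 := ratioH_neq0 alpha_re n; have h7 := dblS_neq0 R n.
have e1 : fourier_int (alpha + n.+1%:R) 0 = 2 * (2 * (alpha + n%:R) + 1) * fourier_int (alpha + n%:R) 0 / (alpha + n%:R + 1).
  by rewrite -(fourier_int_shift (re_shift n)) -[n.+1%:R]natr1 addrA mulfK.
have e2 : (symb_moment n.+1)%:C = 2 * (2 * n%:R + 1) * (symb_moment n)%:C / (n%:R + 1).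
  have := congr1 (real_complex R) (symb_moment_rec n).
  by rewrite !(rmorphM, rmorphD) /= !natrC rmorph1 => <-; rewrite mulfK.
rewrite e1 e2.
have -> : 2 * (alpha + n%:R) + 1 = 2 * (alpha + n%:R + 2^-1) by field.
have -> : 2 * n%:R + 1 = 2 * (n%:R + 2^-1) :> R[i] by field.
move: h1 h2 h3 h4 h5 h6 cn.
set p := alpha + _ + 1; set q := alpha + _ + 2^-1; set r := _ + 2^-1; set s := _ + 1.
move: (ratioB alpha n) (ratioH alpha n) (fourier_int _ 0) ((symb_moment n)%:C) => b h f c h1 h2 h3 h4 h5 h6 cn.
by field; do ?[assumption | apply/andP; split].
Qed.

(** [fourier_int_laplace] applied to [fourier_int_product]. The coefficient cannot
    be 0, for then all the integrals at alpha + n would be 0, against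
    [fourier_int_laplace]. *)
Lemma fourier_coef0_cvg : cvgC (fun n => expC (alpha * (ln (4 : R))%:C) * ratioB alpha n / ratioH alpha n)
   (fourier_int alpha 0 / L%:C) /\ fourier_int alpha 0 / L%:C != 0.
Proof.
set phi := fourier_int alpha 0 / _.
have p4 : powC 4 alpha = expC (alpha * (ln (4 : R))%:C) by [].
have e0 := expC_neq0 (alpha * (ln (4 : R))%:C).
have lap := fourier_int_laplace; rewrite p4 in lap.
have p0 : phi != 0.
  apply/eqP => phi0.
  have : cvgC (fun n => fourier_int (alpha + n%:R) 0 / (symb_moment n)%:C) 0.
    apply: (@cvgC_eq _ (fun=> 0) _ _ 0); last exact: cvgC_cst.
    move=> n _; have := fourier_int_product n; rewrite -/phi phi0 => /eqP.
    rewrite mulf_eq0 mulf_eq0 invr_eq0 (negbTE (ratioB_neq0 alpha_re n)) (negbTE (ratioH_neq0 alpha_re n)) /=.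
    by move=> /eqP ->.
  by move=> /(cvgC_unique lap) e; move: e0; rewrite e eqxx.
split=> //.
have lim : expC (alpha * (ln (4 : R))%:C) * (phi * (expC (alpha * (ln (4 : R))%:C))^-1) = phi.
  by rewrite mulrCA divff // mulr1.
rewrite -[X in cvgC _ X]lim.
apply: (@cvgC_eq _ (fun n => expC (alpha * (ln (4 : R))%:C) * (phi * (fourier_int (alpha + n%:R) 0 / (symb_moment n)%:C)^-1))); last first.
  apply: cvgCM; first exact: cvgC_cst.
  by apply: cvgCM; [exact: cvgC_cst | exact: cvgCV].
move=> n _; rewrite -mulrA; congr (_ * _).
have := fourier_int_product n; rewrite -/phi => e.
have f0 : fourier_int (alpha + n%:R) 0 / (symb_moment n)%:C != 0.
  by apply: contraNneq p0 => f0; rewrite -e f0 mulr0.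
by rewrite -e mulfK.
Unshelve. exact: 0%N.
Qed.

End Laplace.

(** * Conclusion *)
Lemma fourier_fourier_int (R : realType) (alpha : R[i]) (phi : R[i] -> R[i]) (k : int) :
  - (1 / 2) < complex.Re alpha ->
  (forall t : R, 0 < t < 2 * pi -> phi (cis t) = powC (2 - 2 * cos t) alpha) ->
  fourier phi k = fourier_int alpha k / (2 * pi)%:C.
Proof.
move=> ha hphi; have [i1 i2] := integrand_integrable k ha.
have E (p : R[i] -> R) : (@lebesgue_measure R).-integrable `]0, 2 * pi[ (EFin \o (fun t => p (integrand alpha k t))) ->
   \int[@lebesgue_measure R]_(t in `[0, 2 * pi]) p (phi (cis t) * cis (- (k%:~R * t))) =
   \int[@lebesgue_measure R]_(t in `]0, 2 * pi[) p (integrand alpha k t).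
  move=> ip.
  have ip' : (@lebesgue_measure R).-integrable `]0, 2 * pi[
      (EFin \o (fun t => p (phi (cis t) * cis (- (k%:~R * t))))).
    apply: eq_integrable ip; first exact: measurable_period.
    by move=> t; rewrite inE /= in_itv /= => h; rewrite hphi.
  transitivity (\int[@lebesgue_measure R]_(t in `]0, 2 * pi[) p (phi (cis t) * cis (- (k%:~R * t)))).
    have mf := measurable_int _ ip'.
    by rewrite /Rintegral; congr fine; exact: integral_itv_bndoo.
  by apply: eq_Rintegral => t; rewrite inE /= in_itv /= => h; rewrite hphi.
rewrite /fourier /fourier_int mulrC /integralC (E _ i1) (E _ i2) fmorphV /=.
by [].
Qed.

Lemma toeplitz_hankel_det (R : realType) (alpha : R[i]) (phi : R[i] -> R[i]) (n : nat) :
  - (1 / 2) < complex.Re alpha ->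
  (forall t : R, 0 < t < 2 * pi -> phi (cis t) = powC (2 - 2 * cos t) alpha) ->
  \det (toeplitz_hankel phi n) =
  \prod_(k < n) ((fourier_int alpha 0 / (2 * pi)%:C) * (ratioH alpha k * ratioB alpha k /
     (ratioB alpha k.*2 * ratioB alpha k.*2.+1))).
Proof.
move=> ha hphi; have fE k := fourier_fourier_int k ha hphi.
rewrite -fE /toeplitz_hankel; apply: det_toeplitz_hankel_ratio.
- by move=> i; rewrite addrAC; exact: alphaS_neq0.
- by move=> k; rewrite !fE fourier_int_even.
- by move=> k; rewrite !fE !mulrA -mulrDl fourier_int_rec // mul0r.
Qed.

Lemma barnesG1_shift (R : realType) (z w G : R[i]) : z - 1 = w ->
  cvgC (fun n => barnes_prod n w) G ->
  barnesG z = expC (w / 2 * (ln (2 * pi : R))%:C - (w + 1) * w / 2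
     - (euler_gamma R)%:C * w ^+ 2 / 2) * G.
Proof.
move=> zw h; rewrite /barnesG zw /barnesG1 -(cvgC_limn h) /powC -expCD addrA.
by rewrite -[(_ / _ * _) - _]/(_ + - _).
Qed.

(** An epsilon of the complex order is a positive real number. *)
Lemma equiv_of_ratio (R : realType) (f g : nat -> R[i]) : (forall n, g n != 0) ->
  cvgC (fun n => f n / g n) 1 -> (f : nat -> R[i]^o) ~_\oo (g : nat -> R[i]^o).
Proof.
move=> g0 /cvgC_eps h; apply/eqaddoP => /= e e0.
have [eI eR] : complex.Im e = 0 /\ 0 < complex.Re e.
  by move: e0; rewrite ltcE => /andP[/eqP -> ].
have eE : e = (complex.Re e)%:C by apply: eqC_ReIm.
have [N hN] := h _ eR; exists N => // n /= /hN H.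
have nE (z : R[i]) : `|z : R[i]^o| = (normc z)%:C by case: z.
rewrite !nE eE -rmorphM lecR /=.
have -> : (f - g) n = (f n / g n - 1) * g n by rewrite mulrBl divfK ?g0 // mul1r.
by rewrite normcM ler_wpM2r ?normc_ge0.
Qed.

Theorem theorem7p7 (R : realType) (alpha : R[i]) (phi : R[i] -> R[i])
    (alpha_nint : forall m : int, alpha <> m%:~R)
    (alpha_re : - (1 / 2) < complex.Re alpha)
    (phiE : forall t : R, 0 < t < 2 * pi ->
       phi (cis t) = powC (2 - 2 * cos t) alpha) :
  (fun n : nat => \det (toeplitz_hankel phi n) : R[i]^o) ~_\oo
  (fun n : nat =>
     powC n%:R ((alpha ^+ 2 - alpha) / 2)
     * powC (2 * pi) (- alpha / 2)
     * powC 2 (3 * alpha ^+ 2 / 2)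
     * (barnesG (3 / 2 + alpha) * barnesG (1 + alpha) ^+ 2
        / (barnesG (3 / 2) * barnesG (1 + 2 * alpha))) : R[i]^o).
Proof.
have cB (z : R[i]) : - 1 < complex.Re z -> exists2 l, l != 0 & cvgC (fun n => barnes_prod n z) l.
  by move=> hz; apply: cvgC_barnes => k k0; exact: one_add_div_neq0.
have [G1 g1 c1] := cB _ (re_half_alpha alpha_re).
have [G2 g2 c2] := cB _ (re_alpha alpha_re).
have [G3 g3 c3] := cB _ (re_half_gt R).
have [G4 g4 c4] := cB _ (re_2alpha alpha_re).
have [cphi phi0] := fourier_coef0_cvg alpha_re.
have lim := asymptotic_ratio alpha_re erefl phi0 cphi g1 g2 g3 g4 c1 c2 c3 c4.
set a := fun n => \det _; set b := fun n => _ * _.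
have bE n : b n = expC ((alpha ^+ 2 - alpha) / 2 * (ln n%:R)%:C + 3 * alpha ^+ 2 / 2 * (ln 2)%:C
        - (2 * alpha - alpha ^+ 2) / 2 - (euler_gamma R)%:C * (alpha - alpha ^+ 2) / 2)
      * (G1 * G2 ^+ 2 / (G3 * G4)).
  have e1 : 3 / 2 + alpha - 1 = 1 / 2 + alpha by field.
  have e2 : 1 + alpha - 1 = alpha by ring.
  have e3 : 3 / 2 - 1 = 1 / 2 :> R[i] by field.
  have e4 : 1 + 2 * alpha - 1 = 2 * alpha by ring.
  rewrite /b (barnesG1_shift e1 c1) (barnesG1_shift e2 c2) (barnesG1_shift e3 c3).
  rewrite (barnesG1_shift e4 c4) /powC -!expCD.
  (* The exponents of all the prefactors are added up; those of 2 pi cancel. *)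
  have key x0 x1 x2 x3 x4 y : y = x0 + x1 + (x2 + x2) - x3 - x4 ->
      expC x0 * (expC x1 * G1 * (expC x2 * G2) ^+ 2 / (expC x3 * G3 * (expC x4 * G4))) =
      expC y * (G1 * G2 ^+ 2 / (G3 * G4)).
    move=> ->; rewrite !expCB !expCD.
    move: (expC_neq0 x3) (expC_neq0 x4) => h3 h4.
    move: (expC x0) (expC x1) (expC x2) (expC x3) (expC x4) h3 h4 => X0 X1 X2 X3 X4 h3 h4.
    by field; rewrite g3 g4 h3 h4.
  by apply: key; field.
refine (@equiv_of_ratio R a b _ _).
- move=> n; rewrite bE mulf_neq0 ?expC_neq0 // !mulf_neq0 ?invr_eq0 ?expf_neq0 ?mulf_neq0 //.
- apply: (cvgC_eq (N := 0) _ lim) => n _.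
  by rewrite bE /a (toeplitz_hankel_det n alpha_re phiE).
Qed.
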